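(* Let $\mathbf{H}$ and $\mathbf{M}$ be positive selfadjoint operators in a Hilbert space $\mathcal{X}$ having the following property (A): $\mathcal{D}(\mathbf{H}^{1/2})=\mathcal{D}(\mathbf{M}^{1/2})$ and the norms $\|\mathbf{H}^{1/2}\cdot\|$ and $\|\mathbf{M}^{1/2}\cdot\|$ are topologically equivalent. Then the same property is shared by $\mathbf{H}^{1/2}$ and $\mathbf{M}^{1/2}$, that is, $\mathcal{D}(\mathbf{H}^{1/4})=\mathcal{D}(\mathbf{M}^{1/4})$ and the norms $\|\mathbf{H}^{1/4}\cdot\|$ and $\|\mathbf{M}^{1/4}\cdot\|$ are topologically equivalent. The operators $$\overline{\mathbf{M}^{-1/2}\mathbf{H}^{1/2}},\quad\overline{\mathbf{M}^{1/2}\mathbf{H}^{-1/2}},\quad\overline{\mathbf{M}^{-1/4}\mathbf{H}^{1/4}},\quad\overline{\mathbf{M}^{1/4}\mathbf{H}^{-1/4}},$$ $$\overline{\mathbf{H}^{-1/2}\mathbf{M}^{1/2}},\quad\overline{\mathbf{H}^{1/2}\mathbf{M}^{-1/2}},\quad\overline{\mathbf{H}^{-1/4}\mathbf{M}^{1/4}},\quad\overline{\mathbf{H}^{1/4}\mathbf{M}^{-1/4}}$$ are well defined and bounded. Let $$T=\overline{\mathbf{M}^{1/2}\mathbf{H}^{-1/2}}-\overline{\mathbf{M}^{-1/2}\mathbf{H}^{1/2}}\qquad\text{and}\qquad X=\overline{\mathbf{M}^{1/4}\mathbf{H}^{-1/4}}-\overline{\mathbf{M}^{-1/4}\mathbf{H}^{1/4}}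 .$$ Then $$\|X\|\le\frac12\|T\| .$$
   Context: A selfadjoint operator $\mathbf{H}$ is positive if $(\mathbf{H}x,x)>0$ for every nonzero $x\in\mathcal{D}(\mathbf{H})$; then all its fractional powers are positive, and its negative fractional powers are densely defined selfadjoint operators. Neither $\mathbf{H}$, $\mathbf{M}$ nor their inverses need be bounded. $\mathcal{D}(\cdot)$ denotes the domain, the bar denotes the closure of an operator, and products of unbounded operators have their natural (maximal) domains. Topological equivalence of two norms on a common domain means each is bounded by a constant multiple of the other there. ''Well defined and bounded'' means the product is densely defined and bounded, so that its closure is an everywhere defined bounded operator. *)

(* Defs.v *)
From HB Require Import structures.
From mathcomp Require Import all_boot all_order all_algebra.
From mathcomp Require Import complex.
From mathcomp Require Import all_classical all_reals all_analysis.

Set Implicit Arguments.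
Unset Strict Implicit.
Unset Printing Implicit Defensive.

Import Order.TTheory GRing.Theory Num.Theory.
Import numFieldNormedType.Exports.

Local Open Scope classical_set_scope.
Local Open Scope ring_scope.
Local Open Scope complex_scope.

(* Hilbert spaces are complex: a Banach space V over R[i] with a dot product
   [ip] (linear in its first argument, conjugate-linear in the second) that
   induces the norm. Norms have values in the nonnegative reals of R[i], on
   which the (partial) order of R[i] is the usual one; in particular
   [0 < ip x y] says that [ip x y] is real and positive.

   An unbounded operator is identified with its graph, a subset of V * V, so
   that equality of operators includes equality of their domains. *)

Definition induces_norm (R : realType) (V : completeNormedModType R[i])
    (ip : {dot V for (@Num.conj R[i])}) : Prop :=
  forall x : V, ip x x = `|x| ^+ 2.

Section Operators.
Variables (R : realType) (V : completeNormedModType R[i]).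
Implicit Types A B : set (V * V).

Definition is_operator A : Prop :=
  [/\ A (0, 0),
      forall (a : R[i]) (x y u v : V),
        A (x, u) -> A (y, v) -> A (a *: x + y, a *: u + v)
    & forall x u v : V, A (x, u) -> A (x, v) -> u = v].

Definition op_dom A : set V := [set x | exists y, A (x, y)].

Definition densely_defined A : Prop := dense (op_dom A).

(* The inverse is an operator when A is injective; its domain is the range
   of A. *)
Definition op_inv A : set (V * V) := [set p | A (p.2, p.1)].

(* The product A B, i.e. B is applied first. *)
Definition op_mul A B : set (V * V) :=
  [set p | exists2 y, B (p.1, y) & A (y, p.2)].

Definition op_sub A B : set (V * V) :=
  [set p | exists u v, [/\ A (p.1, u), B (p.1, v) & p.2 = u - v]].

Definition op_bounded A : Prop :=
  exists c : R[i], forall x y, A (x, y) -> `|y| <= c * `|x|.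

(* The operator norm; it is +oo when A is unbounded. *)
Definition op_norm A : \bar R :=
  ereal_sup [set z | exists x y, [/\ A (x, y), `|x| <= 1 & z = (complex.Re `|y|)%:E]].

(* A is densely defined and bounded, and the closure of its graph is the graph
   of an everywhere defined bounded operator. *)
Definition closure_well_defined_bounded A : Prop :=
  [/\ is_operator A, densely_defined A, op_bounded A
    & [/\ is_operator (closure A), op_dom (closure A) = setT
        & op_bounded (closure A)]].

Definition equivalent_graph_norms A B : Prop :=
  exists c d : R[i], [/\ 0 < c, 0 < d
    & forall x u v, A (x, u) -> B (x, v) ->
        `|u| <= c * `|v| /\ `|v| <= d * `|u|].

Variable ip : {dot V for (@Num.conj R[i])}.

Definition adjoint A : set (V * V) :=
  [set p | forall x y, A (x, y) -> ip y p.1 = ip x p.2].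

Definition selfadjoint A : Prop :=
  [/\ is_operator A, densely_defined A & adjoint A = A].

Definition positive A : Prop := forall x y, A (x, y) -> x != 0 -> 0 < ip y x.

Definition positive_selfadjoint A : Prop := selfadjoint A /\ positive A.

(* A^(1/2), the unique positive selfadjoint operator whose square, with its
   natural domain, is A. The default value set0 is returned only if no such
   operator exists, which never happens for a positive selfadjoint A. *)
Definition op_sqrt A : set (V * V) :=
  xget set0 [set S | positive_selfadjoint S /\ op_mul S S = A].

(* A^(1/4) *)
Definition op_root4 A : set (V * V) := op_sqrt (op_sqrt A).

(* The equivalence concerns the norms |A^(1/2) x| and |B^(1/2) x| of x in the
   common domain. *)
Definition propertyA A B : Prop :=
  op_dom (op_sqrt A) = op_dom (op_sqrt B) /\
  equivalent_graph_norms (op_sqrt A) (op_sqrt B).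

End Operators.

(* Main.v *)
Require Import Defs.
From HB Require Import structures.
From mathcomp Require Import all_boot all_order all_algebra.
From mathcomp Require Import complex.
From mathcomp Require Import all_classical all_reals all_analysis.
From mathcomp Require Import ring lra.

Set Implicit Arguments.
Unset Strict Implicit.
Unset Printing Implicit Defensive.

Import Order.TTheory GRing.Theory Num.Theory.
Import numFieldNormedType.Exports.

Local Open Scope classical_set_scope.
Local Open Scope ring_scope.

(** Notation: (x, y) is the inner product, |x| the norm; h = H^(1/4),
    m = M^(1/4), B = h^2 = H^(1/2), A = m^2 = M^(1/2). Everything is derived from one
    fact about a positive selfadjoint operator B: the operator 1 + B is onto
    ([resolvent]). It provides the Cayley transform C, which maps u + B u to
    u - B u. This symmetric contraction plays the role of the semigroup
    exp(- s B), and its powers tend strongly to 0 ([cayley_cv0]).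

    The norm estimate. Formally m X h^-1 + m^-1 X h = T, because the two mixed
    terms of the left-hand side cancel. In weak form
      (X x, A y) + (X B x, y) = (T h x, m y)
    ([weak_sylvester]). In terms of semigroups, the value (X x, y) is the integral
    over s of the left-hand side at exp(- s B) x and exp(- s A) y, while the integral
    of |h exp(- s B) x|^2 is |x|^2 / 2, so the Cauchy-Schwarz inequality gives
    |(X x, y)| <= |T| |x| |y| / 2. The discrete version of this argument
    ([sylvester_bound]) replaces the integral by a telescoping sum over powers of
    Cayley transforms; one step is exact, since
      |x|^2 - |C x|^2 = 4 (B u, u)   for x = u + B u,
    and (X x, y) loses exactly twice the left-hand side of the weak equation at u
    and at the corresponding vector v with y = v + A v.

    Property A for the square roots is the Heinz inequality with exponent 1/2
    ([heinz]). It follows from the same mechanism: if |A x| <= c |B x|, then the form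
    c (B x, x) - (A x, x) does not increase along the powers of C and tends to 0,
    hence is nonnegative.

    The quotients. Domination of A by B makes A B^-1 bounded, on the dense range of B.
    For A^-1 B the point is that the ranges of A and B coincide
    ([dominated_ran_sub]): A = W B with W bounded gives, by taking adjoints, that A is
    contained in B W^*.

    Finally, the square roots exist ([psa_sqrt]): for a positive selfadjoint
    operator S, with P = (1 + S)^(-1/2) and Q = (1 - P^2)^(1/2) obtained by an
    iteration ([bounded_sqrt]), the root of S is the graph of all (P x, Q x). *)

(** * The real inner product and its limits *)

Section RealInnerProduct.
Variables (R : realType) (V : completeNormedModType (complex R)).
Variable ip : {dot V for (@Num.conj (complex R))}.
Hypothesis hip : induces_norm ip.

(** The real part of the inner product carries the same norm, and it determines
    the inner product because multiplication by i is an isometry (see [Im_ip]).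
    Working with it keeps all estimates inside an ordered field. *)
Definition rip (x y : V) : R := complex.Re (ip x y).
Definition sqn (x : V) : R := rip x x.

Lemma ripC x y : rip x y = rip y x.
Proof. by rewrite /rip hermC mul1r /=; case: (ip y x). Qed.

Lemma ripDl x y z : rip (x + y) z = rip x z + rip y z.
Proof. by rewrite /rip linearDl /=; move: (ip x z) (ip y z) => [a b] [c d]. Qed.

Lemma ripDr x y z : rip z (x + y) = rip z x + rip z y.
Proof. by rewrite ripC ripDl !(ripC z). Qed.

Lemma ripZl (a : R) x y : rip (real_complex R a *: x) y = a * rip x y.
Proof.
by rewrite /rip linearZl_LR /=; case: (ip x y) => ? ? /=; rewrite mul0r subr0.
Qed.

Lemma ripZr (a : R) x y : rip y (real_complex R a *: x) = a * rip y x.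
Proof. by rewrite ripC ripZl ripC. Qed.

Lemma ripNl x y : rip (- x) y = - rip x y.
Proof.
by rewrite -scaleN1r -(rmorphN1 (real_complex R)) ripZl mulN1r.
Qed.

Lemma ripNr x y : rip y (- x) = - rip y x.
Proof. by rewrite ripC ripNl ripC. Qed.

Lemma rip0l x : rip 0 x = 0.
Proof. by rewrite -(scale0r 0) -(rmorph0 (real_complex R)) ripZl mul0r. Qed.

Lemma rip0r x : rip x 0 = 0. Proof. by rewrite ripC rip0l. Qed.

Definition ripE := (ripDl, ripDr, ripNl, ripNr, ripZl, ripZr, rip0l, rip0r).

Lemma Im_ip x y :
  complex.Im (ip x y) = - rip ((Complex 0 1 : complex R) *: x) y.
Proof.
rewrite /rip linearZl_LR /=.
by case: (ip x y) => u v /=; rewrite mul0r mul1r sub0r opprK.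
Qed.

Lemma normr_Re (x : V) : `|x| = real_complex R (complex.Re `|x|).
Proof. by apply/esym/RRe_real/ger0_real/normr_ge0. Qed.

Lemma sqnE x : sqn x = complex.Re `|x| ^+ 2.
Proof. by rewrite /sqn /rip hip normr_Re -rmorphXn. Qed.

Lemma Re_norm_ge0 (x : V) : 0 <= complex.Re `|x|.
Proof. by rewrite -ler0c -normr_Re normr_ge0. Qed.

Lemma sqn_ge0 x : 0 <= sqn x. Proof. by rewrite sqnE sqr_ge0. Qed.

Lemma sqn_eq0 x : sqn x = 0 -> x = 0.
Proof.
rewrite sqnE => /eqP; rewrite sqrf_eq0 => /eqP h.
by apply/normr0_eq0; rewrite normr_Re h.
Qed.

Lemma rip_ext x y : (forall v, rip x v = rip y v) -> x = y.
Proof.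
move=> h; apply/subr0_eq/sqn_eq0.
by rewrite /sqn ripDl ripNl h subrr.
Qed.

(** The order of the complex field is partial: comparability with 0 already
    forces a number to be real. *)
Lemma gt0_complexE (c : complex R) : 0 < c -> exists2 d : R, 0 < d & c = real_complex R d.
Proof.
move=> c0; exists (complex.Re c); first by move: c0; rewrite ltcE => /andP[].
by apply/esym/RRe_real/gtr0_real.
Qed.

Lemma sqn_le_norm (c : R) x y : 0 <= c ->
  (`|x| <= real_complex R c * `|y|) = (sqn x <= c ^+ 2 * sqn y).
Proof.
move=> c0; rewrite (normr_Re x) (normr_Re y) -rmorphM lecR !sqnE -exprMn.
by rewrite ler_pXn2r // nnegrE ?mulr_ge0 ?Re_norm_ge0.
Qed.

Lemma sqn_lt_norm (e : R) x : 0 < e -> (`|x| < real_complex R e) = (sqn x < e ^+ 2).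
Proof.
move=> e0; rewrite (normr_Re x) ltcR sqnE.
by rewrite ltr_pXn2r // nnegrE ?Re_norm_ge0 // ltW.
Qed.

Lemma sqnD x y : sqn (x + y) = sqn x + 2 * rip x y + sqn y.
Proof. by rewrite /sqn !ripE (ripC y x); ring. Qed.

Lemma sqnN x : sqn (- x) = sqn x.
Proof. by rewrite /sqn !ripE opprK. Qed.

Lemma sqn0 : sqn 0 = 0. Proof. exact: rip0l. Qed.

Lemma sqnB x y : sqn (x - y) = sqn x - 2 * rip x y + sqn y.
Proof. by rewrite sqnD sqnN ripNr; ring. Qed.

Lemma sqnBC x y : sqn (x - y) = sqn (y - x).
Proof. by rewrite -sqnN opprB. Qed.

Lemma sqnZ (a : R) x : sqn (real_complex R a *: x) = a ^+ 2 * sqn x.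
Proof. by rewrite /sqn !ripE; ring. Qed.

Lemma sqnD_le x y : sqn (x + y) <= 2 * sqn x + 2 * sqn y.
Proof. by have := sqn_ge0 (x - y); rewrite sqnB sqnD; lra. Qed.

Lemma rip_le x y : 2 * rip x y <= sqn x + sqn y.
Proof. by have := sqn_ge0 (x - y); rewrite sqnB; lra. Qed.

(** The weighted form of the Cauchy-Schwarz inequality; choosing the weight at
    the point of use replaces all square roots of norms. *)
Lemma rip_leZ (s : R) x y : 0 < s -> 2 * rip x y <= s * sqn x + s^-1 * sqn y.
Proof.
move=> s0; have := rip_le (real_complex R s *: x) y.
rewrite ripZl sqnZ -(ler_pM2r (_ : 0 < s^-1)) ?invr_gt0//.
by congr (_ <= _); field; lra.
Qed.

Lemma sqnD_bound x y (a b : R) : 0 <= a -> 0 <= b ->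
  sqn x <= a ^+ 2 -> sqn y <= b ^+ 2 -> sqn (x + y) <= (a + b) ^+ 2.
Proof.
have pw (z : V) (c : R) : 0 <= c ->
    (sqn z <= c ^+ 2) = (`|z| <= real_complex R c).
  by move=> c0; rewrite sqnE normr_Re lecR ler_pXn2r // nnegrE Re_norm_ge0.
move=> a0 b0; rewrite !pw ?addr_ge0// => xa yb.
by rewrite rmorphD (le_trans (ler_normD _ _)) // lerD.
Qed.

(** Limits are measured by the squared norm, since every estimate below is
    quadratic. *)
Definition cv (u : nat -> V) (l : V) := forall e : R, 0 < e ->
  exists n0, forall n, (n0 <= n)%N -> sqn (u n - l) < e.

Definition adh (D : set V) (x : V) := forall e : R, 0 < e ->
  exists2 y, D y & sqn (x - y) < e.

Lemma sqn_complete (u : nat -> V) :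
  (forall e : R, 0 < e -> exists n0, forall m n, (n0 <= m)%N -> (n0 <= n)%N ->
     sqn (u m - u n) < e) ->
  exists l, cv u l.
Proof.
move=> cu.
have /cauchy_cvg cu' : cauchy (u @ \oo).
  apply: cauchy_exP => e e0; have [d d0 ->] := gt0_complexE e0.
  have [|n0 h] := cu (d ^+ 2); first by rewrite exprn_gt0.
  exists (u n0); exists n0 => // n /= n0n.
  by rewrite -ball_normE /ball_ /= sqn_lt_norm ?h.
exists (lim (u @ \oo)) => e e0.
have se0 : 0 < Num.sqrt e by rewrite sqrtr_gt0.
have /cvgrPdist_lt/(_ (real_complex R (Num.sqrt e))) : u @ \oo --> lim (u @ \oo).
  exact: cu'.
rewrite ltcR => /(_ se0)[n0 _ h]; exists n0 => n /h /=.
by rewrite sqn_lt_norm // sqr_sqrtr ?ltW// sqnBC.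
Qed.

Lemma dense_adh (D : set V) : dense D <-> forall x, adh D x.
Proof.
split=> [dD x e e0|aD O [x Ox] oO].
  have se0 : 0 < Num.sqrt e by rewrite sqrtr_gt0.
  have [|y [xy Dy]] := dD (ball x (real_complex R (Num.sqrt e))) _ (ball_open _ _).
  - by exists x; apply: ballxx; rewrite ltcR.
  - exists y => //; move: xy; rewrite -ball_normE /ball_ /= sqn_lt_norm//.
    by rewrite sqr_sqrtr ?ltW.
have /nbhs_ballP[e /= e0 eO] : nbhs x O by apply: open_nbhs_nbhs.
have [d d0 ed] := gt0_complexE e0; have [|y Dy xy] := aD x (d ^+ 2).
  by rewrite exprn_gt0.
exists y; split => //; apply: eO.
by rewrite ed -ball_normE /ball_ /= sqn_lt_norm.
Qed.

Lemma closure_graph (G : set (V * V)) p : closure G p <->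
  forall e : R, 0 < e ->
    exists q, [/\ G q, sqn (p.1 - q.1) < e & sqn (p.2 - q.2) < e].
Proof.
have bE (e : R) q : 0 < e -> ball p (real_complex R e) q <->
    sqn (p.1 - q.1) < e ^+ 2 /\ sqn (p.2 - q.2) < e ^+ 2.
  move=> e0; rewrite -!sqn_lt_norm //; split.
    by case; rewrite -!ball_normE.
  by case=> h1 h2; split; rewrite -ball_normE.
split=> [cG e e0|aG B /nbhs_ballP[e /= e0 eB]].
  have se0 : 0 < Num.sqrt e by rewrite sqrtr_gt0.
  have [|q [Gq]] := cG (ball p (real_complex R (Num.sqrt e))).
    by apply: nbhsx_ballx; rewrite ltcR.
  by move=> /(bE _ _ se0)[]; rewrite sqr_sqrtr ?ltW// => h1 h2; exists q.
have [d d0 ed] := gt0_complexE e0; have [|q [Gq h1 h2]] := aG (d ^+ 2).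
  by rewrite exprn_gt0.
by exists q; split => //; apply: eB; rewrite ed; apply/bE.
Qed.

End RealInnerProduct.

(** Vector identities with real coefficients become ring identities after
    pairing with an arbitrary vector. *)
Ltac vector_ring :=
  match goal with h : induces_norm _ |- _ =>
    apply: (rip_ext h) => ?; rewrite ?ripE; ring
  end.

(** * Orthogonal projection and the Riesz lemma *)

Section Projection.
Variables (R : realType) (V : completeNormedModType (complex R)).
Variable ip : {dot V for (@Num.conj (complex R))}.
Hypothesis hip : induces_norm ip.
Local Notation r := (rip ip).
Local Notation N := (sqn ip).
Local Notation "a %:C" := (real_complex R a) (at level 1).
Implicit Types (W : set V) (S : set (V * V)).

(** The variational principle: a quadratic function of [s] with its minimum at 0
    has no linear term. It turns minimality into orthogonality, and lets limits
    pass through inner products without tracking epsilons. *)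
Lemma linear_le_quadratic (a b : R) :
  0 <= b -> (forall s, s * a <= s ^+ 2 * b) -> a = 0.
Proof.
move=> b0 h; apply/eqP; rewrite -sqrf_eq0 eq_le sqr_ge0 andbT.
have b1 : 0 < b + 1 by lra.
have := h (a / (b + 1)).
have -> : a / (b + 1) * a = (a ^+ 2 * (b + 1)) / (b + 1) ^+ 2 by field; lra.
have -> : (a / (b + 1)) ^+ 2 * b = (a ^+ 2 * b) / (b + 1) ^+ 2 by field; lra.
by rewrite ler_pM2r ?invr_gt0 ?exprn_gt0 //; lra.
Qed.

Lemma invn_lt (e : R) : 0 < e ->
  exists n0, forall n, (n0 <= n)%N -> n.+1%:R^-1 < e.
Proof.
move=> e0; exists (Num.truncn e^-1) => n hn.
rewrite -(invrK e) ltf_pV2 ?posrE ?ltr0n ?invr_gt0 //.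
apply: lt_le_trans (truncnS_gt _) _.
by rewrite ler_nat ltnS.
Qed.

Lemma sqn_limit (u : nat -> V) (x : V) :
  (forall n, N (x - u n) < n.+1%:R^-1) -> forall e : R, 0 < e ->
  exists n0, forall m n, (n0 <= m)%N -> (n0 <= n)%N -> N (u m - u n) < e.
Proof.
move=> hu e e0; have [|n0 h] := @invn_lt (e / 4); first by rewrite divr_gt0.
exists n0 => m n /h hm /h hn.
have -> : u m - u n = (x - u n) - (x - u m) by vector_ring.
have := sqnD_le hip (x - u n) (- (x - u m)); rewrite sqnN.
by have := lt_trans (hu n) hn; have := lt_trans (hu m) hm; lra.
Qed.

Definition real_subspace W :=
  W 0 /\ forall (a : R) x y, W x -> W y -> W (a%:C *: x + y).

(** Minimise the distance from [z] to [W]: the parallelogram identity makes a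
    minimising sequence Cauchy, and minimality of the limit gives orthogonality.
    The minimiser lies in the closure of [W], so [W] itself may be any
    subspace. *)
Lemma projection W z : real_subspace W ->
  exists2 w, adh ip W w & forall v, W v -> r (z - w) v = 0.
Proof.
move=> Wsub; have [W0 Wl] := Wsub.
pose D := [set N (z - w) | w in W].
have Dinf : has_inf D.
  split; first by exists (N (z - 0)), 0.
  by exists 0 => _ [w _ <-]; apply: sqn_ge0.
pose d := inf D.
have dle w : W w -> d <= N (z - w).
  by move=> Ww; apply: ge_inf; [case: Dinf|exists w].
have /choice[u hu] n : exists w, W w /\ N (z - w) < d + n.+1%:R^-1.
  have [|_ [w Ww <-] hw] := @inf_adherent _ D (n.+1%:R^-1) _ Dinf.
    by rewrite invr_gt0.
  by exists w.
have cu m n : N (u m - u n) <= 2 * m.+1%:R^-1 + 2 * n.+1%:R^-1.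
  have [Wm hm] := hu m; have [Wn hn] := hu n.
  pose a := z - u m; pose b := z - u n.
  have := dle _ (Wl 2^-1 _ _ (Wl 1 _ _ Wm Wn) W0).
  have -> : z - (2^-1%:C *: (1%:C *: u m + u n) + 0) = 2^-1%:C *: (a + b).
    by apply: (rip_ext hip) => v; rewrite !ripE; field.
  have -> : u m - u n = b - a.
    by vector_ring.
  rewrite sqnZ sqnB sqnD.
  have -> : (2^-1 : R) ^+ 2 = 4^-1 by field.
  move: hm hn; rewrite -/a -/b (ripC ip b a).
  move: (m.+1%:R^-1) (n.+1%:R^-1) => em en; lra.
have [e e0|w uw] := @sqn_complete _ _ _ hip u.
  have [|n0 h] := @invn_lt (e / 4); first by rewrite divr_gt0.
  exists n0 => m n /h hm /h hn; move: (cu m n) hm hn.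
  by move: (m.+1%:R^-1) (n.+1%:R^-1) => em en; lra.
exists w.
  move=> e /uw[n0 /(_ n0 (leqnn _)) hn]; exists (u n0); first by case: (hu n0).
  by rewrite sqnBC.
(* the bound d <= N (z - w - s v), at the limit w, is quadratic in s *)
move=> v Wv; apply: (@linear_le_quadratic _ (N v)); first exact: sqn_ge0.
move=> s; apply/ler_addgt0Pr => e e0.
have [n1 h1] := @invn_lt e e0; have [n2 h2] := uw e e0.
pose n := maxn n1 n2.
have {}h1 := h1 n (leq_maxl _ _); have {}h2 := h2 n (leq_maxr _ _).
have [Wn /lt_trans/(_ (_ : _ < d + e))] := hu n.
rewrite ltrD2l => /(_ h1) hn; have := dle _ (Wl s _ _ Wv Wn).
have -> : z - (s%:C *: v + u n) = (z - u n) - s%:C *: v.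
  by vector_ring.
rewrite sqnB sqnZ ripZr.
have := rip_le hip (u n - w) (s%:C *: v); rewrite sqnZ ripZr.
have -> : r (z - w) v = r (z - u n) v + r (u n - w) v by rewrite !ripE; ring.
by have := sqn_ge0 hip v; have := sqr_ge0 s; lra.
Qed.

Lemma perp_dense W : real_subspace W ->
  (forall z, (forall v, W v -> r z v = 0) -> z = 0) -> forall x, adh ip W x.
Proof.
move=> Wsub W0 x; have [w aw /W0 /subr0_eq ->] := projection x Wsub.
exact: aw.
Qed.

(** The representing vector is a multiple of the component of some [x0] with
    [f x0 != 0] orthogonal to the kernel of [f]; boundedness of [f] is what puts
    the closure of the kernel inside the kernel. *)
Lemma riesz (f : V -> R) (k : R) : (forall x y, f (x + y) = f x + f y) ->
  (forall (a : R) x, f (a%:C *: x) = a * f x) ->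
  (forall x, f x ^+ 2 <= k * N x) ->
  exists p, forall x, f x = r x p.
Proof.
move=> fD fZ fk.
have f0 : f 0 = 0 by have := fZ 0 0; rewrite mul0r rmorph0 scale0r.
have fB x y : f (x - y) = f x - f y.
  by rewrite fD -(scaleN1r y) -(rmorphN1 (real_complex R)) fZ mulN1r.
pose W := [set x | f x = 0].
have Wsub : real_subspace W.
  split=> // a x y /= fx fy.
  by rewrite /W /= fD fZ fx fy mulr0 addr0.
have [h|/existsNP[x0 /eqP fx0]] := pselect (forall x, f x = 0).
  by exists 0 => x; rewrite h rip0r.
have [w aw pw] := projection x0 Wsub; pose q := x0 - w.
have fw : f w = 0.
  apply/eqP; rewrite -sqrf_eq0 eq_le sqr_ge0 andbT.
  apply/ler_addgt0Pr => e e0; rewrite add0r.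
  have k1 : 0 < `|k| + 1 by rewrite ltr_wpDl.
  have [|y Wy hy] := aw (e / (`|k| + 1)); first by rewrite divr_gt0.
  have <- : f (w - y) = f w by rewrite fB Wy subr0.
  apply: le_trans (fk _) _.
  have := sqn_ge0 hip (w - y); move: hy; rewrite ltr_pdivlMr // => hy Ny0.
  have := ler_wpM2r Ny0 (ler_norm k); nra.
have fq : f q != 0 by rewrite fB fw subr0.
have Nq : N q != 0.
  apply/eqP => /(sqn_eq0 hip) q0; move: fq.
  by rewrite q0 f0 eqxx.
have {}pw v : W v -> r q v = 0 by apply: pw.
clearbody q; exists ((f q / N q)%:C *: q) => x.
have : r q (x - (f x / f q)%:C *: q) = 0.
  by apply: pw; rewrite /W /= fB fZ; field.
rewrite !ripE -[r q q]/(N q) (ripC ip q x) => /eqP; rewrite subr_eq0 => /eqP ->.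
by field; apply/andP.
Qed.

End Projection.

(** * Positive selfadjoint operators and their resolvents *)

Section SelfadjointOperators.
Variables (R : realType) (V : completeNormedModType (complex R)).
Variable ip : {dot V for (@Num.conj (complex R))}.
Hypothesis hip : induces_norm ip.
Local Notation r := (rip ip).
Local Notation N := (sqn ip).
Local Notation "a %:C" := (real_complex R a) (at level 1).
Implicit Types (W : set V) (S : set (V * V)).

(** Positive selfadjointness with respect to the real inner product. Density of
    the domain is implied: for a vector [z] orthogonal to the domain, [(0, z)]
    satisfies the adjoint relation, so [z = 0]. *)
Definition real_psa S := [/\ is_operator S,
  forall u v, S (u, v) <-> forall x y, S (x, y) -> r y u = r x v &
  forall x y, S (x, y) -> x != 0 -> 0 < r y x].

Lemma opZ S (a : complex R) x y : is_operator S -> S (x, y) -> S (a *: x, a *: y).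
Proof. by move=> [S0 Sl _] Sxy; have := Sl a _ _ _ _ Sxy S0; rewrite !addr0. Qed.

Lemma opD S x y u v : is_operator S -> S (x, u) -> S (y, v) -> S (x + y, u + v).
Proof. by move=> [S0 Sl _] Sx Sy; have := Sl 1 _ _ _ _ Sx Sy; rewrite !scale1r. Qed.

Lemma opB S x y u v : is_operator S -> S (x, u) -> S (y, v) -> S (x - y, u - v).
Proof.
move=> So Sx Sy; have [S0 Sl _] := So; have := Sl (-1) _ _ _ _ Sy Sx.
by rewrite !scaleN1r !(addrC (- _)).
Qed.

Lemma op_fun S x u v : is_operator S -> S (x, u) -> S (x, v) -> u = v.
Proof. by move=> [_ _ Sf]; apply: Sf. Qed.

Lemma dom_subspace S : is_operator S -> real_subspace (op_dom S).
Proof.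
move=> [S0 Sl _]; split; first by exists 0.
by move=> a x y [u Sx] [v Sy]; exists (a%:C *: u + v); apply: Sl.
Qed.

Lemma ran_subspace S : is_operator S -> real_subspace (op_dom (op_inv S)).
Proof.
move=> [S0 Sl _]; split; first by exists 0.
by move=> a x y [u Sx] [v Sy]; exists (a%:C *: u + v); apply: Sl.
Qed.

(** For a complex-linear graph the adjoint relation for Re(x, y) implies the one
    for (x, y): apply it to [i *: x] to recover the imaginary parts. *)
Lemma real_psaP S : positive_selfadjoint ip S <-> real_psa S.
Proof.
have ei (p q : complex R) : complex.Re p = complex.Re q ->
    complex.Im p = complex.Im q -> p = q.
  by move: p q => [a b] [c d] /= -> ->.
have adjE : is_operator S -> forall u v,
    adjoint ip S (u, v) <-> forall x y, S (x, y) -> r y u = r x v.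
  move=> So u v; split=> [h x y /h /= hxy|h x y Sxy /=]; first by rewrite /rip hxy.
  apply: ei; first exact: h.
  by rewrite !Im_ip (h _ _ (opZ _ So Sxy)).
split=> [[[So Sd Sa] Sp]|[So Sa Sp]].
  split=> // [u v|x y /Sp h /h]; first by rewrite -adjE // Sa.
  by rewrite ltcE => /andP[].
split; first split=> //.
- apply/(dense_adh hip); apply: (perp_dense hip (dom_subspace So)) => z hz.
  have /(op_fun So) : S (0, z).
    by apply/Sa => x y Sxy; rewrite rip0r ripC hz //; exists y.
  by apply; case: So.
- by apply/seteqP; split=> -[u v]; [move/(adjE So)/Sa|move/Sa/(adjE So)].
move=> x y Sxy x0; rewrite ltcE (Sp _ _ Sxy x0) andbT /=.
have := (Sa x y).1 Sxy _ _ (opZ (Complex 0 1) So Sxy).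
have : complex.Im (ip x y) = - complex.Im (ip y x).
  by rewrite hermC mul1r /=; case: (ip y x).
by rewrite !Im_ip => h1 h2; apply/eqP; lra.
Qed.

Section Fixed.
Variable S : set (V * V).
Hypothesis Spsa : real_psa S.

Lemma psa_op : is_operator S. Proof. by case: Spsa. Qed.

Lemma psa_adj u v : (forall x y, S (x, y) -> r y u = r x v) -> S (u, v).
Proof. by case: Spsa => _ h _; apply: (h u v).2. Qed.

Lemma psa_sym x y u v : S (x, y) -> S (u, v) -> r y u = r x v.
Proof. by case: Spsa => _ h _ Sx /h; apply. Qed.

Lemma psa_ge0 x y : S (x, y) -> 0 <= r y x.
Proof.
case: Spsa => _ _ h /h; have [->|_ /(_ isT)/ltW//] := eqVneq x 0.
by rewrite rip0r.
Qed.

Lemma psa_eq0 x y : S (x, y) -> r y x <= 0 -> x = 0.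
Proof.
case: Spsa => _ _ h /h; have [//|_ /(_ isT)] := eqVneq x 0.
by rewrite leNgt => ->.
Qed.

(** An adjoint is always closed. *)
Lemma psa_closed x y :
  (forall e, 0 < e -> exists q, [/\ S q, N (x - q.1) < e & N (y - q.2) < e]) ->
  S (x, y).
Proof.
move=> h; apply: psa_adj => a b Sab; apply/eqP; rewrite -subr_eq0; apply/eqP.
apply: (@linear_le_quadratic _ _ (N a + N b)); first by rewrite addr_ge0 ?sqn_ge0.
move=> s; apply/ler_addgt0Pr => e e0; have [[x' y'] [/= Sq hx hy]] := h e e0.
have := psa_sym Sab Sq.
have := rip_le hip (s%:C *: b) (x - x').
have := rip_le hip (- (s%:C *: a)) (y - y').
have := sqr_ge0 s; have := sqn_ge0 hip a; have := sqn_ge0 hip b.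
rewrite sqnN !sqnZ !ripE; nra.
Qed.

Lemma psa_dom_dense x : adh ip (op_dom S) x.
Proof.
by case/real_psaP: Spsa => -[_ /(dense_adh hip)].
Qed.

(** A vector orthogonal to the range is in the kernel of the adjoint, which is
    [S] itself, and [S] is injective. *)
Lemma psa_ran_dense x : adh ip (op_dom (op_inv S)) x.
Proof.
apply: (perp_dense hip (ran_subspace psa_op)) => z hz.
have Sz : S (z, 0).
  by apply: psa_adj => a b Sab; rewrite rip0r ripC hz //; exists a.
by apply: (psa_eq0 Sz); rewrite rip0l.
Qed.

Lemma psa_injective x : S (x, 0) -> x = 0.
Proof. by move=> Sx; apply: (psa_eq0 Sx); rewrite rip0l. Qed.

End Fixed.

Definition clinear (f : V -> V) :=
  forall (a : complex R) x y, f (a *: x + y) = a *: f x + f y.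

Lemma clinearD f x y : clinear f -> f (x + y) = f x + f y.
Proof. by move=> /(_ 1 x y); rewrite !scale1r. Qed.

Lemma clinear0 f : clinear f -> f 0 = 0.
Proof.
move=> fl; have := clinearD 0 0 fl; rewrite addr0 => /eqP.
by rewrite -subr_eq subrr => /eqP.
Qed.

Lemma clinearZ f (a : complex R) x : clinear f -> f (a *: x) = a *: f x.
Proof. by move=> fl; have := fl a x 0; rewrite (clinear0 fl) !addr0. Qed.

Lemma clinearN f x : clinear f -> f (- x) = - f x.
Proof. by move=> fl; rewrite -scaleN1r (clinearZ _ _ fl) scaleN1r. Qed.

Lemma clinearB f x y : clinear f -> f (x - y) = f x - f y.
Proof. by move=> fl; rewrite (clinearD _ _ fl) (clinearN _ fl). Qed.

(** [1 + S] is onto. Its range is dense, because a vector [v] orthogonal to it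
    satisfies [S v = - v], which positivity forbids; its range is closed because
    [N x <= N (x + S x)], so that preimages of a Cauchy sequence form a Cauchy
    sequence. *)
Lemma resolvent S : real_psa S ->
  exists f : V -> V, [/\ clinear f, forall z, S (f z, z - f z) &
    forall x y, S (x, y) -> f (x + y) = x].
Proof.
move=> Sp; have So := psa_op Sp.
have uniq x x' z : S (x, z - x) -> S (x', z - x') -> x = x'.
  move=> h1 h2; apply/subr0_eq.
  apply: (psa_eq0 Sp (opB So h1 h2)).
  have -> : z - x - (z - x') = - (x - x') by vector_ring.
  by rewrite ripNl oppr_le0 sqn_ge0.
pose W := [set z | exists x, S (x, z - x)].
have Wsub : real_subspace W.
  have [S0 Sl _] := So; split; first by exists 0; rewrite subr0.
  move=> a x y [u hu] [v hv]; exists (a%:C *: u + v).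
  have := Sl a%:C _ _ _ _ hu hv.
  by rewrite scalerBr opprD addrACA.
have Wd : forall x, adh ip W x.
  apply: (perp_dense hip Wsub) => v hv; apply: (psa_eq0 Sp (y := - v)).
    apply: (psa_adj Sp) => x y Sxy.
    have : W (x + y) by exists x; rewrite addrAC subrr add0r.
    by move/hv; rewrite !ripE !(ripC ip v); lra.
  by rewrite ripNl oppr_le0 sqn_ge0.
have WT z : exists x, S (x, z - x).
  have /choice[p hp] n : exists p, S (p.1, p.2 - p.1) /\ N (z - p.2) < n.+1%:R^-1.
    have [|y [x Sx] hy] := Wd z (n.+1%:R^-1); first by rewrite invr_gt0.
    by exists (x, y).
  have cz := sqn_limit hip (fun n => (hp n).2).
  have cx e : 0 < e -> exists n0, forall m n, (n0 <= m)%N -> (n0 <= n)%N ->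
      N ((p m).1 - (p n).1) < e.
    move=> /cz[n0 h]; exists n0 => m n hm hn; apply: le_lt_trans (h m n hm hn).
    have := psa_ge0 Sp (opB So (hp m).1 (hp n).1).
    have := rip_le hip ((p m).2 - (p n).2) ((p m).1 - (p n).1).
    by rewrite /sqn !ripE; lra.
  have [x ux] := sqn_complete hip cx.
  exists x; apply: (psa_closed Sp) => e e0.
  have [|n1 h1] := @invn_lt R (e / 4); first by rewrite divr_gt0.
  have [|n2 h2] := ux (e / 4); first by rewrite divr_gt0.
  pose n := maxn n1 n2.
  have {}h1 := h1 n (leq_maxl _ _); have {}h2 := h2 n (leq_maxr _ _).
  have [Sn /lt_trans/(_ h1) hn] := hp n.
  exists ((p n).1, (p n).2 - (p n).1); split => //=.
    by rewrite sqnBC; lra.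
  have -> : z - x - ((p n).2 - (p n).1) = (z - (p n).2) + ((p n).1 - x).
    by vector_ring.
  by have := sqnD_le hip (z - (p n).2) ((p n).1 - x); lra.
have /choice[f hf] := WT; exists f; split => //.
  move=> a x y; apply: uniq (hf _) _.
  have [_ Sl _] := So; have := Sl a _ _ _ _ (hf x) (hf y).
  by rewrite scalerBr opprD addrACA.
move=> x y Sxy; apply: uniq (hf _) _.
by rewrite addrAC subrr add0r.
Qed.

End SelfadjointOperators.

(** * Square roots of bounded positive operators *)

Section BoundedSquareRoot.
Variables (R : realType) (V : completeNormedModType (complex R)).
Variable ip : {dot V for (@Num.conj (complex R))}.
Hypothesis hip : induces_norm ip.
Local Notation r := (rip ip).
Local Notation N := (sqn ip).
Local Notation cv := (cv ip).
Local Notation "a %:C" := (real_complex R a) (at level 1).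
Implicit Types (f g k : V -> V) (u v : nat -> V).

Definition bounded_map f := exists c : R, forall x, N (f x) <= c * N x.
Definition symmetric_map f := forall x y, r (f x) y = r x (f y).

Lemma sqnD_boundZ x y z (a b : R) : 0 <= a -> 0 <= b ->
  N x <= a ^+ 2 * N z -> N y <= b ^+ 2 * N z -> N (x + y) <= (a + b) ^+ 2 * N z.
Proof.
move=> a0 b0; rewrite (sqnE hip z) -!exprMn => xa yb.
by rewrite mulrDl sqnD_bound // mulr_ge0 ?Re_norm_ge0.
Qed.

Lemma sqrMA (a b c : R) : (a * b) ^+ 2 * c = a ^+ 2 * (b ^+ 2 * c).
Proof. by ring. Qed.

Lemma cv_unique u l l' : cv u l -> cv u l' -> l = l'.
Proof.
move=> ul ul'; apply/subr0_eq/(sqn_eq0 hip)/eqP.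
rewrite eq_le sqn_ge0 // andbT; apply/ler_addgt0Pr => e e0; rewrite add0r.
have e4 : 0 < e / 4 by rewrite divr_gt0.
have [n1 h1] := ul _ e4; have [n2 h2] := ul' _ e4; pose n := maxn n1 n2.
have {}h1 := h1 n (leq_maxl _ _); have {}h2 := h2 n (leq_maxr _ _).
have -> : l - l' = (u n - l') - (u n - l) by vector_ring.
by have := sqnD_le hip (u n - l') (- (u n - l)); rewrite sqnN; lra.
Qed.

Lemma cvD u v l l' : cv u l -> cv v l' -> cv (fun n => u n + v n) (l + l').
Proof.
move=> ul vl' e e0; have e4 : 0 < e / 4 by rewrite divr_gt0.
have [n1 h1] := ul _ e4; have [n2 h2] := vl' _ e4.
exists (maxn n1 n2) => n; rewrite geq_max => /andP[/h1 {}h1 /h2 {}h2].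
have -> : u n + v n - (l + l') = (u n - l) + (v n - l') by vector_ring.
by have := sqnD_le hip (u n - l) (v n - l'); lra.
Qed.

Lemma cv_map f u l : clinear f -> bounded_map f ->
  cv u l -> cv (fun n => f (u n)) (f l).
Proof.
move=> fl [c fc] ul e e0; have c1 : 0 < `|c| + 1 by rewrite ltr_wpDl.
have [|n0 h] := ul (e / (`|c| + 1)); first by rewrite divr_gt0.
exists n0 => n /h; rewrite ltr_pdivlMr // -(clinearB _ _ fl) => hn.
have Nx := sqn_ge0 hip (u n - l).
by have := fc (u n - l); have := ler_wpM2r Nx (ler_norm c); nra.
Qed.

Lemma clinear_scale (a : complex R) : clinear (fun x : V => a *: x).
Proof. by move=> b x y; rewrite scalerDr !scalerA mulrC. Qed.

Lemma bounded_scale (a : complex R) : bounded_map (fun x : V => a *: x).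
Proof.
exists (complex.Re `|a| ^+ 2) => x; rewrite !(sqnE hip) normrZ -exprMn.
have -> : `|a| = (complex.Re `|a|)%:C by apply/esym/RRe_real/ger0_real.
by rewrite (normr_Re x) -rmorphM.
Qed.

(** Weak continuity of the inner product; the weight in [rip_leZ] is chosen large
    enough to make the fixed vector [z] negligible. *)
Lemma cv_rip u l z (e : R) : cv u l -> 0 < e ->
  exists n0, forall n, (n0 <= n)%N -> `|r (u n - l) z| < e.
Proof.
move=> ul e0; have z1 : 0 < N z + 1 by rewrite ltr_wpDl ?sqn_ge0.
pose s := (N z + 1) / e; have s0 : 0 < s by rewrite divr_gt0.
have [|n0 h] := ul (e / s); first by rewrite divr_gt0.
exists n0 => n /h; rewrite ltr_pdivlMr // => hn.
have sE : s^-1 * (N z + 1) = e.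
  by rewrite /s invf_div mulrVK // unitfE; lra.
have si : 0 < s^-1 by rewrite invr_gt0.
have := rip_leZ hip (u n - l) z s0.
have := rip_leZ hip (- (u n - l)) z s0.
rewrite sqnN // ripNl ltr_norml => h1 h2; apply/andP; split; nra.
Qed.

Lemma cv_rip_eq u v l l' a b : cv u l -> cv v l' ->
  (forall n, r (u n) a = r b (v n)) -> r l a = r b l'.
Proof.
move=> ul vl' h; apply/subr0_eq/eqP; rewrite -normr_le0.
apply/ler_addgt0Pr => e e0; rewrite add0r.
have e2 : 0 < e / 2 by rewrite divr_gt0.
have [n1 h1] := cv_rip a ul e2; have [n2 h2] := cv_rip b vl' e2.
pose n := maxn n1 n2.
have := h1 n (leq_maxl _ _); have := h2 n (leq_maxr _ _).
have -> : r l a - r b l' = r (v n - l') b - r (u n - l) a.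
  by rewrite !ripE h !(ripC ip b); ring.
have := ler_normB (r (v n - l') b) (r (u n - l) a); lra.
Qed.

Lemma cv_sqn_le u l c : cv u l -> (forall n, N (u n) <= c) -> N l <= c.
Proof.
move=> ul h; apply/ler_addgt0Pr => e e0.
have e2 : 0 < e / 2 by rewrite divr_gt0.
have [n0 /(_ n0 (leqnn _))] := cv_rip l ul e2.
rewrite ripDl ripNl -[r l l]/(N l) ltr_norml => /andP[hl _].
by have := rip_le hip (u n0) l; have := h n0; lra.
Qed.

(** The iterations below converge because each is controlled by a monotone scalar
    sequence. *)
Lemma monotone_cauchy (a : nat -> R) : (forall n, a n.+1 <= a n) ->
  (forall n, 0 <= a n) -> forall e : R, 0 < e ->
  exists n0, forall m n, (n0 <= m)%N -> (n0 <= n)%N -> a m - a n < e.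
Proof.
move=> a_dec a0 e e0; pose D := range a.
have Dinf : has_inf D by split; [exists (a 0%N), 0%N|exists 0 => _ [n _ <-]].
have [|_ [n0 _ <-] hn0] := @inf_adherent _ D e _ Dinf => //.
exists n0 => m n hm hn.
have : a m <= a n0 by apply: (@nonincreasing_seqP _ _ a).1 hm.
have : inf D <= a n by apply: ge_inf; [case: Dinf|exists n].
move=> h1 h2; rewrite ltrBlDl; apply: le_lt_trans h2 _.
by apply: lt_le_trans hn0 _; rewrite lerD2r.
Qed.

Lemma bounded_of_complement f : (forall x, N (x - f x) <= N x) -> bounded_map f.
Proof.
move=> h; exists 4 => x; have {1}-> : f x = x - (x - f x) by vector_ring.
by have := sqnD_le hip x (- (x - f x)); rewrite sqnN; have := h x; lra.
Qed.

Section Iteration.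
Variable f : V -> V.
Hypotheses (fl : clinear f) (fs : symmetric_map f).
Hypothesis fc : forall x, N (x - f x) <= N x.

(** With [a = 1 - f] the equation [(1 - y)^2 = f] reads [y = (a + y^2) / 2].
    Iterating from 0 gives polynomials in [a] with nonnegative coefficients, so
    for [a] a contraction everything is dominated by the scalar iteration
    [sqrt_bound] at [a = 1], which increases and stays below 1. *)
Fixpoint sqrt_iter n x : V :=
  if n is m.+1 then 2^-1%:C *: (x - f x + sqrt_iter m (sqrt_iter m x)) else 0.

Fixpoint sqrt_bound n : R := if n is m.+1 then (1 + sqrt_bound m ^+ 2) / 2 else 0.

Local Notation Y := sqrt_iter.
Local Notation y := sqrt_bound.

Lemma sqrt_bound_itv n : 0 <= y n <= 1.
Proof. by elim: n => [|n /andP[h1 h2]] /=; [lra|nra]. Qed.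

Lemma sqrt_bound_incr n : y n <= y n.+1.
Proof. by have /andP[h1 h2] := sqrt_bound_itv n => /=; nra. Qed.

Lemma sqrt_bound_mono m n : (m <= n)%N -> y m <= y n.
Proof. exact: ((@nondecreasing_seqP _ _ y).1 sqrt_bound_incr). Qed.

Lemma sqrt_iter_clinear n : clinear (Y n).
Proof.
elim: n => [|n IHn] a x z /=; first by rewrite scaler0 addr0.
rewrite fl !IHn scalerA mulrC -scalerA -scalerDr; congr (_ *: _).
by rewrite !scalerDr scalerN opprD (addrACA (a *: x)) [LHS]addrACA.
Qed.

Lemma sqrt_iter_symmetric n : symmetric_map (Y n).
Proof.
elim: n => [|n IHn] x z /=; first by rewrite !ripE.
by rewrite !ripE fs !IHn.
Qed.

Lemma sqrt_iter_bound n x : N (Y n x) <= y n ^+ 2 * N x.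
Proof.
elim: n x => [|n IHn] x /=; first by rewrite sqn0 expr0n /= mul0r.
have y2 : N (Y n (Y n x)) <= (y n ^+ 2) ^+ 2 * N x.
  apply: le_trans (IHn _) _; rewrite [in leRHS]expr2 -mulrA.
  by rewrite ler_wpM2l ?sqr_ge0.
have x1 : N (x - f x) <= 1 ^+ 2 * N x by rewrite expr1n mul1r.
rewrite sqnZ [_ / 2]mulrC sqrMA ler_wpM2l ?sqr_ge0 //.
by apply: sqnD_boundZ; rewrite ?sqr_ge0.
Qed.

(** The difference of squares is split as
    [Y' Y' - Y Y = (Y' - Y) Y' + Y (Y' - Y)], so that the scalar increments obey
    the same recursion. *)
Lemma sqrt_iter_step n x :
  N (Y n.+1 x - Y n x) <= (y n.+1 - y n) ^+ 2 * N x.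
Proof.
elim: n x => [|n IHn] x.
  by have := sqrt_iter_bound 1 x; rewrite /= !subr0.
have -> : Y n.+2 x - Y n.+1 x = 2^-1%:C *:
    ((Y n.+1 (Y n.+1 x) - Y n (Y n.+1 x)) + Y n (Y n.+1 x - Y n x)).
  rewrite (clinearB _ _ (sqrt_iter_clinear n)) [Y n.+2 x]/= [Y n.+1 x in LHS]/=.
  rewrite -scalerBr; congr (_ *: _); rewrite -/(Y n.+1 x); vector_ring.
have -> : y n.+2 - y n.+1 = 2^-1 *
    ((y n.+1 - y n) * y n.+1 + y n * (y n.+1 - y n)).
  by rewrite /=; field.
have /andP[yn0 _] := sqrt_bound_itv n; have /andP[ym0 _] := sqrt_bound_itv n.+1.
have dy : 0 <= y n.+1 - y n by rewrite subr_ge0 sqrt_bound_incr.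
rewrite sqnZ sqrMA ler_wpM2l ?sqr_ge0 //.
apply: sqnD_boundZ (mulr_ge0 dy ym0) (mulr_ge0 yn0 dy) _ _.
  apply: le_trans (IHn _) _; rewrite sqrMA ler_wpM2l ?sqr_ge0 //.
  exact: sqrt_iter_bound.
apply: le_trans (sqrt_iter_bound _ _) _.
by rewrite sqrMA ler_wpM2l ?sqr_ge0.
Qed.

Lemma sqrt_iter_dist m n x : (m <= n)%N ->
  N (Y n x - Y m x) <= (y n - y m) ^+ 2 * N x.
Proof.
elim: n => [|n IHn]; first by rewrite leqn0 => /eqP ->; rewrite !subrr sqn0 expr0n mul0r.
rewrite leq_eqVlt ltnS => /orP[/eqP <-|mn].
  by rewrite !subrr sqn0 expr0n mul0r.
have -> : Y n.+1 x - Y m x = (Y n.+1 x - Y n x) + (Y n x - Y m x).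
  by vector_ring.
have -> : y n.+1 - y m = (y n.+1 - y n) + (y n - y m) by ring.
apply: sqnD_boundZ; rewrite ?subr_ge0 ?sqrt_bound_incr ?sqrt_iter_step ?IHn //.
exact: sqrt_bound_mono.
Qed.

Lemma sqrt_iter_commute k n x : clinear k -> (forall x, k (f x) = f (k x)) ->
  k (Y n x) = Y n (k x).
Proof.
move=> kl kf; elim: n x => [|n IHn] x /=; first exact: clinear0.
by rewrite clinearZ // clinearD // clinearB // kf !IHn.
Qed.

Lemma sqrt_iter_cv x : exists l, cv (Y^~ x) l.
Proof.
apply: (sqn_complete hip) => e e0.
have x1 : 0 < N x + 1 by rewrite ltr_wpDl ?sqn_ge0.
have [|||n0 h] := @monotone_cauchy (fun n => 1 - y n) _ _ (e / (N x + 1)).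
- by move=> n; have := sqrt_bound_incr n; lra.
- by move=> n; have := sqrt_bound_itv n; lra.
- by rewrite divr_gt0.
exists n0 => m n hm hn.
wlog mn : m n hm hn / (m <= n)%N.
  by move=> H; have /orP[/H|/H] := leq_total m n; [|rewrite sqnBC //]; apply.
rewrite sqnBC //; apply: le_lt_trans (sqrt_iter_dist x mn) _.
have := h m n hm hn; rewrite ltr_pdivlMr //.
have := sqrt_bound_itv m; have := sqrt_bound_itv n => /andP[a1 a2] /andP[b1 b2].
have : y m <= y n by apply: sqrt_bound_mono.
have -> : 1 - y m - (1 - y n) = y n - y m by ring.
move=> ymn; have := sqn_ge0 hip x; set t := y n - y m => Nx ht.
have t0 : 0 <= t by rewrite subr_ge0.
have t1 : t <= 1 by rewrite /t; lra.
have : t ^+ 2 * N x <= t * N x by rewrite ler_wpM2r // expr2 ler_piMr.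
nra.
Qed.

(** The contraction hypothesis on [1 - f] contains the positivity of [f], as it
    means [|f x|^2 <= 2 (f x, x)], and it is inherited by the root
    [g = 1 - lim Y_n], so that roots can be iterated. The root is a strong
    limit of polynomials in [f], hence commutes with every bounded operator that
    commutes with [f]. *)
Lemma bounded_sqrt : exists g, [/\ clinear g, symmetric_map g,
  forall x, N (x - g x) <= N x, forall x, g (g x) = f x &
  forall k, clinear k -> bounded_map k -> (forall x, k (f x) = f (k x)) ->
    forall x, k (g x) = g (k x)].
Proof.
have /choice[L hL] := sqrt_iter_cv.
have Ybd n : bounded_map (Y n) by exists (y n ^+ 2); apply: sqrt_iter_bound.
have Yle n x : N (Y n x) <= N x.
  have /andP[h1 h2] := sqrt_bound_itv n.
  by apply: le_trans (sqrt_iter_bound _ _) _; rewrite ler_piMl ?sqn_ge0 // expr_le1.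
have Ll : clinear L.
  move=> a x z; apply: cv_unique (hL _) _.
  have -> : Y^~ (a *: x + z) = (fun n => a *: Y n x + Y n z).
    by apply/funext => n; apply: sqrt_iter_clinear.
  by apply: cvD (hL z); apply: cv_map (clinear_scale a) (bounded_scale a) (hL x).
have LL x : L x = 2^-1%:C *: (x - f x + L (L x)).
  apply: (@cv_unique (fun n => Y n.+1 x)).
    by move=> e /(hL x)[n0 h]; exists n0 => n hn; apply: h; apply: leqW.
  apply: (@cv_map _ (fun n => x - f x + Y n (Y n x))); first exact: clinear_scale.
    exact: bounded_scale.
  apply: cvD; first by move=> e e0; exists 0%N => n _; rewrite subrr sqn0.
  move=> e e0; have e4 : 0 < e / 4 by rewrite divr_gt0.
  have [n1 h1] := hL x _ e4; have [n2 h2] := hL (L x) _ e4.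
  exists (maxn n1 n2) => n; rewrite geq_max => /andP[/h1 {}h1 /h2 {}h2].
  have -> : Y n (Y n x) - L (L x) = Y n (Y n x - L x) + (Y n (L x) - L (L x)).
    by rewrite (clinearB _ _ (sqrt_iter_clinear n)) addrA subrK.
  have := sqnD_le hip (Y n (Y n x - L x)) (Y n (L x) - L (L x)).
  by have := Yle n (Y n x - L x); lra.
exists (fun x => x - L x); split.
- by move=> a x z; rewrite Ll scalerBr opprD addrACA.
- move=> x z; have := cv_rip_eq (hL x) (hL z) (fun n => sqrt_iter_symmetric n x z).
  by rewrite !ripE => ->.
- move=> x; have -> : x - (x - L x) = L x by vector_ring.
  by apply: (cv_sqn_le (hL x)) => n; apply: Yle.
- move=> x; rewrite (clinearB _ _ Ll); apply: (rip_ext hip) => v.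
  by have /= := congr1 (r^~ v) (LL x); rewrite !ripE; lra.
move=> k kl kb kf x; rewrite (clinearB _ _ kl); congr (_ - _).
apply: cv_unique (cv_map kl kb (hL x)) _.
have -> : (fun n => k (Y n x)) = Y^~ (k x); last exact: hL.
by apply/funext => n; apply: sqrt_iter_commute.
Qed.

End Iteration.
End BoundedSquareRoot.

(** * Square roots of unbounded positive operators *)

Section OperatorSquareRoot.
Variables (R : realType) (V : completeNormedModType (complex R)).
Variable ip : {dot V for (@Num.conj (complex R))}.
Hypothesis hip : induces_norm ip.
Local Notation r := (rip ip).
Local Notation N := (sqn ip).
Local Notation "a %:C" := (real_complex R a) (at level 1).

(** Let [B] be the resolvent [(1 + A)^-1], [P = B^(1/2)] and
    [Q = (1 - B)^(1/2)], so that [A = (1 - B) B^-1] and [P^2 + Q^2 = 1]. The root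
    is [S = Q P^-1], given as the graph of all [(P x, Q x)]. If [Q u = P v] then
    [(u, v)] is the image of [P u + Q v]: this single computation yields both
    [adjoint S = S] and [S S = A]. *)
Lemma psa_sqrt (A : set (V * V)) : real_psa ip A ->
  exists S, real_psa ip S /\ op_mul S S = A.
Proof.
move=> Ap; have [B [Bl BA AB]] := resolvent hip Ap.
have Bs : symmetric_map ip B.
  by move=> x y; have := psa_sym Ap (BA x) (BA y); rewrite !ripE; lra.
have Bpos x : N (B x) <= r x (B x).
  by have := psa_ge0 Ap (BA x); rewrite !ripE /sqn; lra.
have B1 x : N (B x) <= N x by have := rip_le hip x (B x); have := Bpos x; lra.
have B2 x : N (x - B x) <= N x.
  by rewrite sqnB; have := Bpos x; have := sqn_ge0 hip (B x); lra.
have Binj x : B x = 0 -> x = 0.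
  move=> h; have := BA x; rewrite h subr0 => /(op_fun (psa_op Ap)).
  by apply; case: (psa_op Ap).
have B'inj x : x - B x = 0 -> x = 0.
  move=> h; have := BA x; rewrite h => /(psa_injective Ap); exact: Binj.
have [P [Pl Ps Pc PP Pk]] := bounded_sqrt hip Bl Bs B2.
have B'l : clinear (fun x => x - B x).
  by move=> a x y; rewrite Bl scalerBr opprD addrACA.
have [||Q [Ql Qs Qc QQ Qk]] := bounded_sqrt hip B'l.
- by move=> x y; rewrite !ripE Bs.
- by move=> x; have -> : x - (x - B x) = B x by vector_ring.
(* P' = P^(1/2) exhibits (Q P z, z) as (Q P' z, P' z), which is nonnegative *)
have [P' [P'l P's P'c P'P' P'k]] := bounded_sqrt hip Pl Ps Pc.
have Pbd := bounded_of_complement hip Pc; have Qbd := bounded_of_complement hip Qc.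
have PQ x : P (Q x) = Q (P x).
  by apply: Qk => // z; rewrite (clinearB _ _ Pl) -!PP.
have QP' x : Q (P' x) = P' (Q x) by apply: P'k => // z; rewrite PQ.
have PPQQ x : P (P x) + Q (Q x) = x by rewrite PP QQ addrC subrK.
have Pinj x : P x = 0 -> x = 0.
  by move=> Px; apply: Binj; rewrite -PP Px (clinear0 Pl).
have Qpos x : N (Q x) <= 2 * r (Q x) x.
  by have := Qc x; rewrite sqnB (ripC ip x); lra.
exists [set p | exists x, p = (P x, Q x)]; split; last first.
  apply/seteqP; split=> -[u v] /=.
    move=> [w [x [-> ->]] [y [Qx ->]]].
    have := BA (P x + Q y); rewrite -QQ -PP !(clinearD _ _ Pl) !(clinearD _ _ Ql).
    rewrite (PQ y) -Qx -(clinearD _ _ Pl) PPQQ.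
    by rewrite -(PQ x) Qx -(clinearD _ _ Ql) PPQQ.
  move=> Auv; have uE := AB _ _ Auv; set z := u + v in uE.
  have -> : v = Q (Q z) by rewrite QQ uE /z addrAC subrr add0r.
  have -> : u = P (P z) by rewrite PP.
  exists (Q (P z)); first by exists (P z).
  by exists (Q z); rewrite PQ.
split.
- split; first by exists 0; rewrite (clinear0 Pl) (clinear0 Ql).
    by move=> a x y u v [z [-> ->]] [w [-> ->]]; exists (a *: z + w); rewrite Pl Ql.
  move=> x u v [z [-> ->]] [w [zw ->]]; congr Q.
  by apply/subr0_eq/Pinj; rewrite (clinearB _ _ Pl) zw subrr.
- move=> u v; split=> [[z [-> ->]] x y [w [-> ->]]|h].
    by rewrite Qs -PQ Ps.
  have hq : Q u = P v.
    apply: (rip_ext hip) => w; rewrite Qs Ps (ripC ip u) (ripC ip v).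
    by apply: h; exists w.
  exists (P u + Q v); rewrite (clinearD _ _ Pl) (clinearD _ _ Ql).
  congr pair; first by rewrite PQ -hq PPQQ.
  by rewrite -PQ hq PPQQ.
move=> x y [z [-> ->]] Pz0.
have e : r (Q z) (P z) = r (Q (P' z)) (P' z) by rewrite -P'P' -P's QP'.
have := Qpos (P' z); have := sqn_ge0 hip (Q (P' z)); rewrite -e => h1 h2.
rewrite lt_neqAle; apply/andP; split; last lra.
apply/eqP => e0; move: Pz0; rewrite -P'P'.
suff -> : P' z = 0 by rewrite (clinear0 P'l) eqxx.
apply: B'inj; rewrite -QQ; suff -> : Q (P' z) = 0 by rewrite (clinear0 Ql).
apply: (sqn_eq0 hip); lra.
Qed.

End OperatorSquareRoot.

(** * Quotients of mutually dominated operators *)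

Section Quotients.
Variables (R : realType) (V : completeNormedModType (complex R)).
Variable ip : {dot V for (@Num.conj (complex R))}.
Hypothesis hip : induces_norm ip.
Local Notation r := (rip ip).
Local Notation N := (sqn ip).
Local Notation cv := (cv ip).
Local Notation "a %:C" := (real_complex R a) (at level 1).
Implicit Types (A B G : set (V * V)).

Lemma closure_cv G x y : closure G (x, y) <->
  exists u : nat -> V * V, [/\ forall n, G (u n),
    cv (fun n => (u n).1) x & cv (fun n => (u n).2) y].
Proof.
split=> [/(closure_graph hip) h|[u [Gu ux uy]]]; last first.
  apply/(closure_graph hip) => e e0 /=.
  have [n1 h1] := ux e e0; have [n2 h2] := uy e e0; pose n := maxn n1 n2.
  exists (u n); split; rewrite // sqnBC //.
    by apply: h1; rewrite leq_maxl.
  by apply: h2; rewrite leq_maxr.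
have /choice[u hu] n : exists q, [/\ G q, N (x - q.1) < n.+1%:R^-1 &
    N (y - q.2) < n.+1%:R^-1] by apply: h; rewrite invr_gt0.
exists u; split=> [n|e /invn_lt[n0 h0]|e /invn_lt[n0 h0]]; first by case: (hu n).
- exists n0 => n /h0 hn; rewrite sqnBC //.
  by apply: lt_trans hn; case: (hu n).
- exists n0 => n /h0 hn; rewrite sqnBC //.
  by apply: lt_trans hn; case: (hu n).
Qed.

Lemma rip_sqr x y : r x y ^+ 2 <= N x * N y.
Proof.
have [y0|y0] := eqVneq (N y) 0.
  by rewrite (sqn_eq0 hip y0) rip0r sqn0 mulr0 expr0n.
have Ny : 0 < N y by rewrite lt_def y0 sqn_ge0.
have := sqn_ge0 hip (x - (r x y / N y)%:C *: y).
rewrite sqnB sqnZ ripZr -(ler_pM2r Ny) mul0r.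
have -> : (N x - 2 * (r x y / N y * r x y) + (r x y / N y) ^+ 2 * N y) * N y =
  N x * N y - r x y ^+ 2 by field.
by rewrite subr_ge0.
Qed.

Lemma cv_sqn u x (e : R) : cv u x -> 0 < e ->
  exists n0, forall n, (n0 <= n)%N -> `|N (u n) - N x| < e.
Proof.
move=> ux e0; have e4 : 0 < e / 4 by rewrite divr_gt0.
have [n1 h1] := cv_rip hip x ux e4; have [n2 h2] := ux _ e4.
exists (maxn n1 n2) => n; rewrite geq_max => /andP[/h1 {}h1 /h2 {}h2].
have -> : N (u n) - N x = 2 * r (u n - x) x + N (u n - x).
  by rewrite /sqn !ripE (ripC ip x); ring.
move: h1; rewrite !ltr_norml => /andP[h3 h4].
have Nu := sqn_ge0 hip (u n - x); apply/andP; split; lra.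
Qed.

Lemma cv_sqn_le_sqn u v x y (k : R) : 0 <= k -> cv u x -> cv v y ->
  (forall n, N (v n) <= k * N (u n)) -> N y <= k * N x.
Proof.
move=> k0 ux vy h; apply/ler_addgt0Pr => e e0.
have k1 : 0 < k + 1 by lra.
have e1 : 0 < e / (k + 1) by rewrite divr_gt0.
have [n1 h1] := cv_sqn ux e1; have [n2 h2] := cv_sqn vy e1.
have eE : e = e / (k + 1) * (k + 1) by field; lra.
rewrite {}eE; move: (e / (k + 1)) h1 h2 => d h1 h2.
pose n := maxn n1 n2; move: (h1 n (leq_maxl _ _)) (h2 n (leq_maxr _ _)).
rewrite !ltr_norml => /andP[_ a1] /andP[a2 _].
have : k * N (u n) <= k * (N x + d) by rewrite ler_wpM2l //; lra.
by have := h n; lra.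
Qed.

(** [dominated k A B] says that the domain of [B] is contained in that of [A] and
    that [k^(1/2)] bounds the norm of [A] by that of [B] there. Equivalence of
    graph norms on a common domain is domination both ways. *)
Definition dominated (k : R) A B :=
  forall x v, B (x, v) -> exists2 u, A (x, u) & N u <= k * N v.

(** Extension by continuity: images of a sequence converging to [x] form a Cauchy
    sequence. *)
Lemma bounded_closure G (k : R) : 0 <= k -> is_operator G ->
  (forall x, adh ip (op_dom G) x) -> (forall x y, G (x, y) -> N y <= k * N x) ->
  exists f, [/\ clinear f, forall x, N (f x) <= k * N x &
    forall x y, closure G (x, y) <-> y = f x].
Proof.
move=> k0 Go Gd Gk.
have cl_ex x : exists y, closure G (x, y).
  have /choice[p hp] n : exists q, G q /\ N (x - q.1) < n.+1%:R^-1.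
    have [|z [y Gzy] hz] := Gd x (n.+1%:R^-1); first by rewrite invr_gt0.
    by exists (z, y).
  have cp := sqn_limit hip (fun n => (hp n).2).
  have k1 : 0 < k + 1 by lra.
  have [e e0|y cy] := @sqn_complete _ _ _ hip (fun n => (p n).2).
    have [|n0 h] := cp (e / (k + 1)); first by rewrite divr_gt0.
    exists n0 => m n hm hn; move: (h m n hm hn); rewrite ltr_pdivlMr //.
    have Gp n' : G ((p n').1, (p n').2) by case: (hp n'); case: (p n').
    have := Gk _ _ (opB Go (Gp m) (Gp n)).
    by have := sqn_ge0 hip ((p m).1 - (p n).1); lra.
  exists y; apply/closure_cv; exists p; split=> // [n|e /invn_lt[n0 h]].
    by case: (hp n).
  exists n0 => n /h hn; rewrite sqnBC //.
  by apply: lt_trans hn; case: (hp n).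
have cl_lin (a : complex R) x y u v : closure G (x, u) -> closure G (y, v) ->
    closure G (a *: x + y, a *: u + v).
  move=> /closure_cv[p [Gp px pu]] /closure_cv[q [Gq qy qv]]; apply/closure_cv.
  have cZ w l := cv_map hip (clinear_scale a) (bounded_scale hip a) (u := w) (l := l).
  exists (fun n => (a *: (p n).1 + (q n).1, a *: (p n).2 + (q n).2)); split => /=.
  - move=> n; case: Go => _ Gl _; apply: Gl.
      by move: (Gp n); case: (p n).
    by move: (Gq n); case: (q n).
  - exact: cvD (cZ _ _ px) qy.
  - exact: cvD (cZ _ _ pu) qv.
have cl_bound x y : closure G (x, y) -> N y <= k * N x.
  move=> /closure_cv[p [Gp px py]]; apply: (cv_sqn_le_sqn k0 px py) => n.
  by apply: Gk; move: (Gp n); case: (p n).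
have cl_fun x y y' : closure G (x, y) -> closure G (x, y') -> y = y'.
  move=> h h'; apply/subr0_eq/(sqn_eq0 hip)/eqP; rewrite eq_le sqn_ge0 // andbT.
  have := cl_bound _ _ (cl_lin (-1) _ _ _ _ h' h).
  by rewrite !scaleN1r !(addrC (- _)) subrr sqn0 mulr0.
have /choice[f hf] := cl_ex; exists f; split=> // [a x y|x|x y].
- by apply: cl_fun (hf _) _; apply: cl_lin.
- exact: cl_bound.
- by split=> [h|->//]; apply: cl_fun h (hf x).
Qed.

Lemma bounded_closure_well_defined G (k : R) : 0 <= k -> is_operator G ->
  (forall x, adh ip (op_dom G) x) -> (forall x y, G (x, y) -> N y <= k * N x) ->
  closure_well_defined_bounded G.
Proof.
move=> k0 Go Gd Gk; have [f [fl fk fG]] := bounded_closure k0 Go Gd Gk.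
split=> //; first exact/(dense_adh hip).
- exists (Num.sqrt k)%:C => x y /Gk.
  by rewrite (sqn_le_norm hip) ?sqrtr_ge0 // sqr_sqrtr.
split.
- split; first by apply/fG; rewrite (clinear0 fl).
    by move=> a x y u v /fG -> /fG ->; apply/fG; rewrite fl.
  by move=> x u v /fG -> /fG ->.
- by apply/seteqP; split=> // x _; exists (f x); apply/fG.
- exists (Num.sqrt k)%:C => x y /fG ->.
  by rewrite (sqn_le_norm hip) ?sqrtr_ge0 // sqr_sqrtr.
Qed.

Lemma op_mul_inv_is_operator A B : is_operator A -> real_psa ip B ->
  is_operator (op_mul A (op_inv B)).
Proof.
move=> [A0 Al Af] Bp; have [B0 Bl Bf] := psa_op Bp; split; first by exists 0.
  by move=> a x y u v [p /= Bx Au] [q /= By Av]; exists (a *: p + q);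
    [apply: Bl|apply: Al].
move=> x u v [p /= Bx Au] [q /= By Av].
suff pq : p = q by move: Au; rewrite pq => /Af; apply.
apply/subr0_eq/(psa_injective Bp); have := opB (psa_op Bp) Bx By.
by rewrite subrr.
Qed.

Lemma op_inv_mul_is_operator A B : real_psa ip A -> is_operator B ->
  is_operator (op_mul (op_inv A) B).
Proof.
move=> Ap [B0 Bl Bf]; have [A0 Al Af] := psa_op Ap; split; first by exists 0.
  by move=> a x y u v [p /= Bx Au] [q /= By Av]; exists (a *: p + q);
    [apply: Bl|apply: Al].
move=> x u v [p /= Bx Au] [q /= By Av].
have pq := Bf _ _ _ Bx By; apply/subr0_eq/(psa_injective Ap).
by have := opB (psa_op Ap) Au Av; rewrite pq subrr.
Qed.

Section Dominated.
Variables (A B : set (V * V)) (k : R).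
Hypotheses (Ap : real_psa ip A) (Bp : real_psa ip B).
Hypotheses (k0 : 0 < k) (AB : dominated k A B).

Lemma mul_inv_bound x y : op_mul A (op_inv B) (x, y) -> N y <= k * N x.
Proof.
move=> [p /= Bp' Ay]; have [u Au] := AB Bp'.
by rewrite (op_fun (psa_op Ap) Ay Au).
Qed.

Lemma mul_inv_dense x : adh ip (op_dom (op_mul A (op_inv B))) x.
Proof.
move=> e e0; have [y [p /= Bpy] hy] := psa_ran_dense hip Bp x e0.
by exists y => //; have [u Au _] := AB Bpy; exists u, p.
Qed.

Lemma mul_inv_closure : exists f, [/\ clinear f, forall x, N (f x) <= k * N x,
  (forall x y, closure (op_mul A (op_inv B)) (x, y) <-> y = f x) &
  forall x u v, B (x, u) -> A (x, v) -> f u = v].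
Proof.
have [f [fl fk fG]] := bounded_closure (ltW k0)
  (op_mul_inv_is_operator (psa_op Ap) Bp) mul_inv_dense mul_inv_bound.
exists f; split => // x u v Bx Ax; apply/esym/fG/subset_closure.
by exists x.
Qed.

(** Write [A = W B] on the domain of [B], with [W] bounded. Taking adjoints,
    [A] is contained in [B W^*]; in particular the range of [A] is contained in
    that of [B]. The vector [W^* x] is supplied by the Riesz lemma. *)
Lemma dominated_ran_sub x y : A (x, y) -> exists z, B (z, y).
Proof.
move=> Axy; have [f [fl fk _ fBA]] := mul_inv_closure.
have [|||p hp] := @riesz _ _ _ hip (fun w => r (f w) x) (k * N x).
- by move=> w w'; rewrite (clinearD _ _ fl) ripDl.
- by move=> a w; rewrite (clinearZ _ _ fl) ripZl.
- move=> w; apply: le_trans (rip_sqr _ _) _.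
  by rewrite (mulrAC k) ler_wpM2r ?sqn_ge0.
exists p; apply: (psa_adj Bp) => u w Bu.
have [u' Au _] := AB Bu.
by rewrite -hp (fBA _ _ _ Bu Au) (psa_sym Ap Au Axy).
Qed.

(** The inclusion of ranges makes [B^-1 A] defined on the whole domain of [A]. *)
Lemma inv_mul_dense x : adh ip (op_dom (op_mul (op_inv B) A)) x.
Proof.
move=> e e0; have [y [a Aya] hy] := psa_dom_dense hip Ap x e0; exists y => //.
by have [z Bza] := dominated_ran_sub Aya; exists z, a.
Qed.

(** [B^-1 A] is contained in the adjoint of [A B^-1]; the pairing is tested on the
    dense range of [B]. *)
Lemma inv_mul_bound x z : op_mul (op_inv B) A (x, z) -> N z <= k * N x.
Proof.
move=> [y /= Axy Bzy]; apply/ler_addgt0Pr => e e0.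
have [b [u /= Bu] hb] := psa_ran_dense hip Bp z e0.
have [a Aua ha] := AB Bu.
have := sqnB ip z b; have := psa_sym Bp Bzy Bu; have := psa_sym Ap Axy Aua.
have := rip_leZ hip x a k0.
have : k^-1 * N a <= N b by rewrite ler_pdivrMl.
by lra.
Qed.

End Dominated.

(** The last clause says that [f] is the adjoint of [A B^-1], which gives access
    to [f x] for vectors [x] outside the domain of [A]. *)
Lemma inv_mul_closure A B (k l : R) : real_psa ip A -> real_psa ip B ->
  0 < k -> 0 < l -> dominated k A B -> dominated l B A ->
  exists f, [/\ clinear f, forall x, N (f x) <= k * N x,
  (forall x y, closure (op_mul (op_inv B) A) (x, y) <-> y = f x),
  (forall x y z, A (x, y) -> B (z, y) -> f x = z) &
  forall x z a b, B (z, b) -> A (z, a) -> r (f x) b = r x a].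
Proof.
move=> Ap Bp k0 l0 AB BA; pose G := op_mul (op_inv B) A.
have Go : is_operator G := op_inv_mul_is_operator Bp (psa_op Ap).
have [f [fl fk fG]] := bounded_closure (ltW k0) Go
  (inv_mul_dense Ap Bp k0 AB) (inv_mul_bound Ap Bp k0 AB).
exists f; split=> // [x y z Axy Bzy|x z a b Bzb Aza].
  by apply/esym/fG/subset_closure; exists y.
have /closure_cv[u [Gu ux uf]] : closure G (x, f x) by apply/fG.
rewrite (ripC ip x); apply: (cv_rip_eq hip uf ux) => n.
have [y /= Axy Bzy] := Gu n.
by rewrite -(psa_sym Bp Bzy Bzb) (psa_sym Ap Axy Aza) ripC.
Qed.

End Quotients.

(** * Cayley transforms and the Heinz inequality *)

Section Cayley.
Variables (R : realType) (V : completeNormedModType (complex R)).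
Variable ip : {dot V for (@Num.conj (complex R))}.
Hypothesis hip : induces_norm ip.
Local Notation r := (rip ip).
Local Notation N := (sqn ip).
Local Notation cv := (cv ip).
Local Notation "a %:C" := (real_complex R a) (at level 1).

Section Resolvent.
Variables (B : set (V * V)) (Res : V -> V).
Hypotheses (Bp : real_psa ip B) (Rl : clinear Res).
Hypotheses (RB : forall z, B (Res z, z - Res z)).
Hypotheses (BR : forall x y, B (x, y) -> Res (x + y) = x).

(** With [u = Res z] one has [z = u + B u] and [cayley z = u - B u]. *)
Definition cayley z := Res z - (z - Res z).
Local Notation C := cayley.

Lemma resolvent_symmetric : symmetric_map ip Res.
Proof. by move=> x y; have := psa_sym Bp (RB x) (RB y); rewrite !ripE; lra. Qed.

Lemma resolvent_sqn_le z : N (Res z) <= N z.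
Proof.
have := psa_ge0 Bp (RB z); have := rip_le hip z (Res z).
by rewrite !ripE /sqn; lra.
Qed.

Lemma resolvent_compl_le z : N (z - Res z) <= N z.
Proof.
have := psa_ge0 Bp (RB z); have := sqn_ge0 hip (Res z).
by rewrite sqnB !ripE /sqn; lra.
Qed.

Lemma resolvent_bounded : bounded_map ip Res.
Proof. by exists 1 => x; rewrite mul1r resolvent_sqn_le. Qed.

(** The loss of norm in one step measures the form [(B u, u)]; this is the discrete
    counterpart of [d/ds |e^(-sB) x|^2 = - 2 (B y, y)] for [y = e^(-sB) x]. *)
Lemma cayley_sqn z : N z - N (C z) = 4 * r (z - Res z) (Res z).
Proof. by rewrite /C /sqn !ripE !(ripC ip (Res z)); ring. Qed.

Lemma cayley_sqn_le z : N (C z) <= N z.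
Proof. by have := cayley_sqn z; have := psa_ge0 Bp (RB z); lra. Qed.

Lemma cayley_clinear : clinear C.
Proof.
move=> a x y; rewrite /C Rl (opprD (a *: Res x)) (addrACA (a *: x)) -scalerBr.
by rewrite opprD addrACA -scalerBr.
Qed.

Lemma cayley_symmetric : symmetric_map ip C.
Proof.
by move=> x y; have := resolvent_symmetric x y; rewrite /C !ripE; lra.
Qed.

(** As [C] is a symmetric contraction, the inner product of [C^(2m) z] and
    [C^(2n) z] is the squared norm of [C^(m + n) z]. These squared norms decrease, so
    the even powers form a Cauchy sequence. The limit [l] satisfies [C (C l) = l],
    hence loses no norm, which forces [(B u, u) = 0] for its resolvent [u] and
    [l = 0]. *)
Lemma cayley_cv0 z : cv (fun n => iter n C z) 0.
Proof.
pose a n := N (iter n C z).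
have a_dec n : a n.+1 <= a n by rewrite /a iterS cayley_sqn_le.
have it_rip m n x y : r (iter m C x) (iter n C y) = r (iter (m + n) C x) y.
  elim: n m x y => [|n IHn] m x y; first by rewrite addn0.
  by rewrite addnS -addSn -IHn -cayley_symmetric.
have [e e0|l hl] := @sqn_complete _ _ _ hip (fun n => iter n.*2 C z).
  have [||n0 h] := @monotone_cauchy _ a a_dec _ (e / 2).
  - by move=> n; apply: sqn_ge0.
  - by rewrite divr_gt0.
  exists n0 => m n hm hn; rewrite sqnB.
  have -> : r (iter m.*2 C z) (iter n.*2 C z) = a (m + n)%N.
    by rewrite /a [RHS]it_rip it_rip -addnn -addnn addnACA.
  have hm2 : (n0 <= m.*2)%N by rewrite -addnn (leq_trans hm) ?leq_addr.
  have hn2 : (n0 <= n.*2)%N by rewrite -addnn (leq_trans hn) ?leq_addr.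
  have hmn : (n0 <= m + n)%N by rewrite (leq_trans hm) ?leq_addr.
  have := h _ _ hm2 hmn; have := h _ _ hn2 hmn.
  rewrite -[N (iter m.*2 _ _)]/(a m.*2) -[N (iter n.*2 _ _)]/(a n.*2); lra.
(* the shifted sequence has the same limit *)
have CCl : C (C l) = l.
  have Cb : bounded_map ip C by exists 1 => x; rewrite mul1r cayley_sqn_le.
  have h := cv_map hip cayley_clinear Cb (cv_map hip cayley_clinear Cb hl).
  apply: (cv_unique hip h) => e /hl[n0 hn0]; exists n0 => n hn.
  by rewrite -!iterS -doubleS; apply: hn0; rewrite leqW.
have l0 : l = 0.
  have Rl0 : Res l = 0.
    apply: (psa_eq0 Bp (RB l)); have := cayley_sqn l.
    by have := cayley_sqn_le (C l); rewrite CCl; lra.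
  have := RB l; rewrite Rl0 subr0 => /(op_fun (psa_op Bp)); apply.
  by case: (psa_op Bp).
move=> e /hl[n0 /(_ n0 (leqnn _))]; rewrite l0 !subr0 => hn0.
exists n0.*2 => n hn; rewrite subr0; apply: le_lt_trans hn0.
exact: ((@nonincreasing_seqP _ _ a).1 a_dec _ _ hn).
Qed.

End Resolvent.

(** Along the Cayley transform of [B] the form
    [q(x) = c (B x, x) - (A x, x)] cannot increase: with [x = u + w], [w = B u],
    one step lowers it by [4 (c |w|^2 - (A u, w))], and [|A u| <= c |w|]. Since
    [C^n x] tends to 0 while [B C^n x] stays bounded, the limit of [q] is 0, so
    [q(x)] is nonnegative. *)
Lemma heinz_core (A B : set (V * V)) (c : R) : 0 < c ->
  real_psa ip A -> real_psa ip B -> dominated ip (c ^+ 2) A B ->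
  forall x a b, A (x, a) -> B (x, b) -> r a x <= c * r b x.
Proof.
move=> c0 Ap Bp AB; have [Res [Rl RB BR]] := resolvent hip Bp.
have Ao := psa_op Ap; have Bo := psa_op Bp.
pose C := cayley Res.
have step x a b : A (x, a) -> B (x, b) -> exists a' b',
    [/\ A (C x, a'), B (C x, b'), N b' <= N b &
        c * r b' (C x) - r a' (C x) <= c * r b x - r a x].
  move=> Axa Bxb; pose u := Res x; pose w := x - u.
  have Bu : B (u, w) by apply: RB.
  have Bw : B (w, b - w) by apply: opB.
  have [au Au hu] := AB _ _ Bu; have [aw Aw _] := AB _ _ Bw.
  have xE : x = u + w by rewrite addrC subrK.
  have CE : C x = u - w by [].
  clearbody u w; subst x.
  have aE : a = au + aw.
    by apply: (op_fun Ao Axa); apply: opD.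
  rewrite CE; exists (au - aw), (w - (b - w)); split; [exact: opB|exact: opB| |].
    have := psa_ge0 Bp Bw; have := ripC ip w b; have := sqnB ip w (b - w).
    by rewrite /sqn !ripE; lra.
  rewrite aE.
  have h1 := psa_sym Ap Au Aw; have h2 := psa_sym Bp Bw Bu.
  have := rip_leZ hip au w (_ : 0 < c^-1); rewrite invr_gt0 invrK => /(_ c0).
  have : c^-1 * N au <= c * N w.
    by rewrite ler_pdivrMl // mulrA -expr2.
  move: h1 (congr1 ( *%R c) h2) (ripC ip u aw); rewrite /sqn !ripE; lra.
move=> x a b Axa Bxb.
have iterC n : exists a' b', [/\ A (iter n C x, a'), B (iter n C x, b'), N b' <= N b &
        c * r b' (iter n C x) - r a' (iter n C x) <= c * r b x - r a x].
  elim: n => [|n [a' [b' [An Bn hb hq]]]]; first by exists a, b.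
  have [a2 [b2 [A2 B2 hb2 hq2]]] := step _ _ _ An Bn.
  by exists a2, b2; split=> //; [apply: le_trans hb|apply: le_trans hq].
rewrite -subr_ge0; apply/ler_addgt0Pr => e e0.
(* K bounds |c B y - A y|^2 for every iterate y; the weight s splits e between
   this bound and N y *)
pose K := 4 * c ^+ 2 * N b + 1.
have K0 : 0 < K.
  by have := mulr_ge0 (sqr_ge0 c) (sqn_ge0 hip b); rewrite /K; lra.
pose s := e / K; have s0 : 0 < s by rewrite divr_gt0.
have [|n0 /(_ n0 (leqnn _))] := cayley_cv0 Bp Rl RB x (_ : 0 < e * s).
  by rewrite mulr_gt0.
rewrite subr0; have [a' [b' [An Bn hb hq]]] := iterC n0.
set y := iter n0 C x in An Bn hq * => hy.
have := rip_leZ hip (- (c%:C *: b' - a')) y s0.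
have : N (c%:C *: b' - a') <= K.
  have := sqnD_le hip (c%:C *: b') (- a'); rewrite sqnN sqnZ.
  have [a2 A2 ha2] := AB _ _ Bn; rewrite (op_fun Ao An A2).
  have : c ^+ 2 * N b' <= c ^+ 2 * N b by rewrite ler_wpM2l ?sqr_ge0.
  by rewrite /K; lra.
move=> /(ler_wpM2l (ltW s0)).
have -> : s * K = e by rewrite /s; field; lra.
have : s^-1 * N y < e by rewrite ltr_pdivrMl // mulrC.
by rewrite sqnN !ripE; lra.
Qed.

(** Heinz inequality for the exponent 1/2. [heinz_core] gives the estimate on the
    domain of [B = h h]. To reach the domain of [h], parametrise it as the range of
    the resolvent of [h]: this resolvent maps the (dense) domain of [h] into that
    of [B], and [m] composed with it is bounded, so it extends to the whole space
    because [m] is closed. *)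
Theorem heinz (A B m h : set (V * V)) (c : R) : 0 < c ->
  real_psa ip m -> real_psa ip h -> real_psa ip A -> real_psa ip B ->
  op_mul m m = A -> op_mul h h = B ->
  dominated ip (c ^+ 2) A B -> dominated ip c m h.
Proof.
move=> c0 mp hp Ap Bp mA hB AB.
have [Res [Rl Rh hR]] := resolvent hip hp.
have [mo ho] := (psa_op mp, psa_op hp).
have core x : op_dom B x -> exists2 y, m (x, y) & forall v, h (x, v) -> N y <= c * N v.
  move=> [b Bxb]; have [a Axa _] := AB _ _ Bxb.
  have := heinz_core c0 Ap Bp AB Axa Bxb.
  move: Axa Bxb; rewrite -mA -hB => -[y /= mxy mya] [v /= hxv hvb] hle.
  exists y => // v' hxv'; rewrite (op_fun ho hxv' hxv).
  by rewrite /sqn (psa_sym mp mxy mya) (psa_sym hp hxv hvb) !(ripC ip x).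
pose G := [set p : V * V | op_dom h p.1 /\ m (Res p.1, p.2)].
have hB' z v : h (z, v) -> h (Res z, z - Res z) /\ h (z - Res z, v - (z - Res z)).
  by move=> hz; split; [apply: Rh|apply: opB].
have domB z : op_dom h z -> op_dom B (Res z).
  by move=> [v /hB'[h1 h2]]; rewrite -hB; exists (v - (z - Res z)), (z - Res z).
have Gbd z y : G (z, y) -> N y <= c * N (z - Res z).
  by move=> [/domB/core[y' my' hy'] /= my]; rewrite (op_fun mo my my'); apply: hy'.
have Go : is_operator G.
  split.
  - have [h0 _ _] := ho; have [m0 _ _] := mo.
    by split; [exists 0|rewrite /= (clinear0 Rl)].
  - move=> a x y u v [/= [x' hx] mx] [/= [y' hy] my]; split.
      by exists (a *: x' + y'); case: ho => _ hl _; apply: hl.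
    by rewrite /= Rl; case: mo => _ ml _; apply: ml.
  - by move=> x u v [_ /= mu] [_ /= mv]; apply: (op_fun mo mu mv).
have Gd z : adh ip (op_dom G) z.
  move=> e e0; have [y [v hy] zy] := psa_dom_dense hip hp z e0.
  exists y => //; have [y' my' _] := core _ (domB _ (ex_intro _ _ hy)).
  by exists y'; split => //; exists v.
have [|f [fl fk fG]] := bounded_closure hip (ltW c0) Go Gd.
  move=> x y /Gbd/le_trans; apply; rewrite ler_wpM2l ?(ltW c0) //.
  exact: resolvent_compl_le hp Rh x.
move=> x v hxv; have xE := hR _ _ hxv; pose z := x + v.
have /(closure_cv hip)[u [Gu uz uf]] : closure G (z, f z) by apply/fG.
exists (f z).
  apply: (psa_closed hip mp) => e e0 /=; rewrite -xE -/z.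
  have [n1 h1] := cv_map hip Rl (resolvent_bounded hp Rh) uz e0.
  have [n2 h2] := uf e e0; pose n := maxn n1 n2.
  exists (Res (u n).1, (u n).2); split => /=.
  - by case: (Gu n).
  - by rewrite sqnBC // h1 ?leq_maxl.
  - by rewrite sqnBC // h2 ?leq_maxr.
have zE : v = z - Res z by rewrite /z xE addrAC subrr add0r.
have lR : clinear (fun w => w - Res w).
  by move=> a y w; rewrite Rl opprD addrACA -scalerBr.
have bR : bounded_map ip (fun w => w - Res w).
  by exists 1 => w; rewrite mul1r; apply: resolvent_compl_le hp Rh w.
rewrite zE; apply: (cv_sqn_le_sqn hip (ltW c0) (cv_map hip lR bR uz) uf) => n.
by apply: Gbd; move: (Gu n); case: (u n).
Qed.

End Cayley.

(** * The weak Sylvester equation *)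

Section Sylvester.
Variables (R : realType) (V : completeNormedModType (complex R)).
Variable ip : {dot V for (@Num.conj (complex R))}.
Hypothesis hip : induces_norm ip.
Local Notation r := (rip ip).
Local Notation N := (sqn ip).
Local Notation cv := (cv ip).
Local Notation "a %:C" := (real_complex R a) (at level 1).

Lemma adh_cv D x : adh ip D x -> exists u, (forall n, D (u n)) /\ cv u x.
Proof.
move=> aD; have /choice[u hu] n : exists y, D y /\ N (x - y) < n.+1%:R^-1.
  by have [|y] := aD (n.+1%:R^-1); [rewrite invr_gt0|exists y].
exists u; split=> [n|e /invn_lt[n0 h]]; first by case: (hu n).
exists n0 => n /h hn; rewrite sqnBC //.
by apply: lt_trans hn; case: (hu n).
Qed.

Lemma cv_rip2 u v x y (e : R) : cv u x -> cv v y -> 0 < e ->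
  exists n0, forall n, (n0 <= n)%N -> `|r (u n) (v n) - r x y| < e.
Proof.
move=> ux vy e0; have e4 : 0 < e / 4 by rewrite divr_gt0.
have [n1 h1] := cv_rip hip y ux e4; have [n2 h2] := cv_rip hip x vy e4.
have [n3 h3] := ux _ e4; have [n4 h4] := vy _ e4.
exists (maxn (maxn n1 n2) (maxn n3 n4)) => n; rewrite !geq_max.
move=> /andP[/andP[/h1 {}h1 /h2 {}h2] /andP[/h3 {}h3 /h4 {}h4]].
have -> : r (u n) (v n) - r x y =
    r (u n - x) y + r (v n - y) x + r (u n - x) (v n - y).
  by rewrite !ripE !(ripC ip x); ring.
have h5 := rip_le hip (u n - x) (v n - y).
have := rip_le hip (- (u n - x)) (v n - y); rewrite sqnN ripNl => h6.
move: h1 h2; rewrite !ltr_norml => /andP[a1 a2] /andP[b1 b2].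
apply/andP; split; lra.
Qed.

(** Functions of [B = h h] preserve the range of [h]. This allows the Sylvester
    equation to be tested on vectors [h f] only. *)
Lemma cayley_ran (B h : set (V * V)) (Res : V -> V) :
  is_operator h -> op_mul h h = B -> clinear Res ->
  (forall z, B (Res z, z - Res z)) -> (forall x y, B (x, y) -> Res (x + y) = x) ->
  forall f x, h (f, x) -> h (Res f, Res x) /\ h (cayley Res f, cayley Res x).
Proof.
move=> ho hB Rl RB BR f x hfx.
have : h (Res f, Res x).
  have := RB f; rewrite -{1}hB => -[w /= h1 h2].
  have : B (w, x - w) by rewrite -hB; exists (f - Res f) => //=; apply: opB.
  by move=> /BR; rewrite addrC subrK => ->.
by move=> h1; split=> //; apply: opB => //; apply: opB.
Qed.

(** Let [C], [D] be the Cayley transforms of [B], [A]. With [x = u + B u] and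
    [y = v + A v], the quantities of second order cancel in
    [(X x, y) - (X C x, D y) = 2 ((X u, A v) + (X B u, v))]. By the hypothesis the
    right-hand side is at most [t ((B u, u) + (A v, v))], which [cayley_sqn] equates
    with a quarter of [t] times the total loss of squared norm. Hence
    [F x y = (X x, y) - t / 4 (|x|^2 + |y|^2)] does not decrease along
    [(C^n x, D^n y)], where it tends to 0, and so [F <= 0]. *)
Lemma sylvester_bound (A B m h : set (V * V)) (X : V -> V) (t : R) :
  0 <= t -> real_psa ip A -> real_psa ip B -> real_psa ip m -> real_psa ip h ->
  op_mul m m = A -> op_mul h h = B -> clinear X -> bounded_map ip X ->
  (forall f x p q g y s w, h (f, x) -> h (x, p) -> h (p, q) ->
     m (g, y) -> m (y, s) -> m (s, w) ->
     2 * (r (X x) w + r (X q) y) <= t * (r q x + r w y)) ->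
  forall x, N (X x) <= (t / 2) ^+ 2 * N x.
Proof.
move=> t0 Ap Bp mp hp mA hB Xl [k Xk] weak.
have [ResA [RAl RA AR]] := resolvent hip Ap.
have [ResB [RBl RB BR]] := resolvent hip Bp.
have [mo ho] := (psa_op mp, psa_op hp).
pose C := cayley ResB; pose D := cayley ResA.
pose F x y := r (X x) y - t / 4 * (N x + N y).
have step f x g y : h (f, x) -> m (g, y) ->
    [/\ h (C f, C x), m (D g, D y) & F x y <= F (C x) (D y)].
  move=> hfx mgy; have [h1 h2] := cayley_ran ho hB RBl RB BR hfx.
  have [m1 m2] := cayley_ran mo mA RAl RA AR mgy; split=> //.
  have := RB x; rewrite -{1}hB => -[p /= hp1 hp2].
  have := RA y; rewrite -{1}mA => -[s /= ms1 ms2].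
  have := weak _ _ _ _ _ _ _ _ h1 hp1 hp2 m1 ms1 ms2.
  have := cayley_sqn ip ResB x; have := cayley_sqn ip ResA y.
  rewrite -/C -/D /F => e1 e2.
  have -> : r (X (C x)) (D y) = r (X x) y
      - 2 * (r (X (ResB x)) (y - ResA y) + r (X (x - ResB x)) (ResA y)).
    by rewrite /C /D /cayley !(clinearB _ _ Xl) !ripE; ring.
  have eN : N (C x) + N (D y) = N x + N y - 4 * (r (x - ResB x) (ResB x) +
      r (y - ResA y) (ResA y)) by lra.
  by rewrite eN; lra.
have F0 f x g y : h (f, x) -> m (g, y) -> F x y <= 0.
  move=> hfx mgy.
  have it n : [/\ h (iter n C f, iter n C x), m (iter n D g, iter n D y) &
      F x y <= F (iter n C x) (iter n D y)].
    elim: n => [|n [h1 m1 Fn]]; first by [].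
    by have [h2 m2 F2] := step _ _ _ _ h1 m1; split=> //; apply: le_trans F2.
  apply/ler_addgt0Pr => e e0; rewrite add0r.
  have k1 : 0 < `|k| + 1 by rewrite ltr_wpDl.
  have e1 : 0 < e / (`|k| + 1) by rewrite divr_gt0.
  have [n1 h1] := cayley_cv0 hip Bp RBl RB x e1.
  have [n2 h2] := cayley_cv0 hip Ap RAl RA y e1.
  pose n := maxn n1 n2; have [_ _ Fn] := it n.
  have {}h1 := h1 n (leq_maxl _ _); have {}h2 := h2 n (leq_maxr _ _).
  apply: (le_trans Fn); move: h1 h2; rewrite !subr0.
  move: (iter n C x) (iter n D y) => x' y'.
  rewrite !ltr_pdivlMr // /F => h1 h2.
  have x0 := sqn_ge0 hip x'; have y0 := sqn_ge0 hip y'.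
  have := rip_le hip (X x') y'; have := Xk x'.
  have := ler_wpM2r x0 (ler_norm k); have := mulr_ge0 (normr_ge0 k) y0.
  have := mulr_ge0 t0 x0; have := mulr_ge0 t0 y0; lra.
(* the ranges of h and m are dense and F is continuous *)
have F1 x y : F x y <= 0.
  have [u [hu ux]] := adh_cv (psa_ran_dense hip hp x).
  have [v [mv vy]] := adh_cv (psa_ran_dense hip mp y).
  apply/ler_addgt0Pr => e e0; rewrite add0r.
  have e2 : 0 < e / 2 by rewrite divr_gt0.
  have et : 0 < e / (t + 1) by rewrite divr_gt0 // ltr_wpDl.
  have [n1 h1] := cv_rip2 (cv_map hip Xl (ex_intro _ k Xk) ux) vy e2.
  have [n2 h2] := cv_sqn hip ux et; have [n3 h3] := cv_sqn hip vy et.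
  pose n := maxn n1 (maxn n2 n3).
  have {h1} := h1 n (leq_maxl _ _).
  have {h2} := h2 n (leq_trans (leq_maxl _ _) (leq_maxr _ _)).
  have {h3} := h3 n (leq_trans (leq_maxr _ _) (leq_maxr _ _)).
  have [[f hf] [g mg]] := (hu n, mv n).
  have := F0 _ _ _ _ hf mg; rewrite /F.
  have eE : e / (t + 1) * (t + 1) = e by field; lra.
  have eS : t * (e / (t + 1)) <= e.
    by rewrite -[leRHS]eE mulrC ler_wpM2l ?(ltW et) // lerDl.
  rewrite !ltr_norml => a0 /andP[_ a3] /andP[_ a2] /andP[a1 _].
  have := ler_wpM2l t0 (ltW a3); have := ler_wpM2l t0 (ltW a2); lra.
move=> x; have [tz|tn0] := eqVneq t 0.
  have := F1 x (X x); rewrite /F tz !mul0r expr0n mul0r subr0; exact.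
have tp : 0 < t by rewrite lt_def tn0.
(* this multiple of X x maximises F x *)
have := F1 x ((2 / t)%:C *: X x); rewrite /F ripZr sqnZ.
have -> : (2 / t) * r (X x) (X x) - t / 4 * (N x + (2 / t) ^+ 2 * N (X x)) =
    (N (X x) - (t / 2) ^+ 2 * N x) / t by rewrite /sqn; field.
by rewrite pmulr_lle0 ?invr_gt0 // subr_le0.
Qed.

(** Formally [m X h^-1 + m^-1 X h = T] for [X = m h^-1 - m^-1 h] and
    [T = m^2 h^-2 - m^-2 h^2]: the two mixed terms are 1 and cancel. Here the
    identity is paired with [p = h x] and [s = m y], and [x = h f], [y = m g] lie in
    the ranges of [h] and [m], which makes each of the four terms computable with
    [f], [g] and the domains of the square roots alone. *)
Lemma weak_sylvester (A B m h : set (V * V)) (c d k l : R) 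
  (W Wi T1 T2 : V -> V) :
  0 < k -> 0 < l -> real_psa ip A -> real_psa ip B -> real_psa ip m -> real_psa ip h ->
  op_mul m m = A -> op_mul h h = B -> 
  dominated ip c A B -> dominated ip d B A -> dominated ip k m h -> dominated ip l h m ->
  (forall x u v, h (x, u) -> m (x, v) -> W u = v) ->
  (forall x y z, h (x, y) -> m (z, y) -> Wi x = z) ->
  (forall x z a b, m (z, b) -> h (z, a) -> r (Wi x) b = r x a) ->
  (forall x u v, B (x, u) -> A (x, v) -> T1 u = v) ->
  (forall x z a b, A (z, b) -> B (z, a) -> r (T2 x) b = r x a) ->
  forall f x p q g y s w, h (f, x) -> h (x, p) -> h (p, q) ->
     m (g, y) -> m (y, s) -> m (s, w) ->
  r (W x - Wi x) w + r (W q - Wi q) y = r (T1 p - T2 p) s.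
Proof.
move=> k0 l0 Ap Bp mp hp mA hB AB BA mh hm hW hWi hWi' hT1 hT2 f x p q g y s w.
move=> hfx hxp hpq mgy mys msw; have [mo ho] := (psa_op mp, psa_op hp).
have Bfp : B (f, p) by rewrite -hB; exists x.
have [f2 Af2 _] := AB _ _ Bfp.
have [f1 /= mf1 mf2] : op_mul m m (f, f2) by rewrite mA.
have Ags : A (g, s) by rewrite -mA; exists y.
have [g2 Bg2 _] := BA _ _ Ags.
have [g1 /= hg1 hg2] : op_mul h h (g, g2) by rewrite hB.
have [p1 mp1 _] := mh _ _ hpq.
have [v mvp] := dominated_ran_sub hip hp mp l0 hm hxp.
rewrite (hW _ _ _ hfx mf1) (hWi _ _ _ hxp mvp) (hW _ _ _ hpq mp1).
rewrite (hT1 _ _ _ Bfp Af2) !ripDl !ripNl (hWi' _ _ _ _ mgy hg1) (hT2 _ _ _ _ Ags Bg2).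
rewrite (psa_sym mp mf2 msw) -(psa_sym mp mvp msw) (psa_sym mp mp1 mys).
by rewrite (psa_sym hp hpq hg2); ring.
Qed.

End Sylvester.

(** * Operator norms *)

Section OperatorNorm.
Variables (R : realType) (V : completeNormedModType (complex R)).
Variable ip : {dot V for (@Num.conj (complex R))}.
Hypothesis hip : induces_norm ip.
Local Notation N := (sqn ip).
Local Notation "a %:C" := (real_complex R a) (at level 1).

Lemma op_norm_ge0 (T : set (V * V)) : T (0, 0) -> (0 <= op_norm T)%E.
Proof.
move=> T0; apply: ereal_sup_ubound; exists 0, 0; split=> //.
  by rewrite normr0 ler01.
by rewrite normr0.
Qed.

Lemma le_op_norm (T : set (V * V)) (f : V -> V) (t : R) : clinear f ->
  (forall x y, T (x, y) <-> y = f x) -> op_norm T = t%:E ->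
  forall x, N (f x) <= t ^+ 2 * N x.
Proof.
move=> fl Tf Tt x.
have [->|x0] := eqVneq x 0; first by rewrite (clinear0 fl) sqn0 mulr0.
pose n := complex.Re `|x|.
have n0 : 0 < n by rewrite -ltcR -normr_Re normr_gt0.
pose y := n^-1%:C *: x.
have Ny : N y = 1 by rewrite sqnZ (sqnE hip x) -/n; field; rewrite gt_eqF.
have t0 : 0 <= t.
  by rewrite -lee_fin -Tt op_norm_ge0 //; apply/Tf; rewrite (clinear0 fl).
have : complex.Re `|f y| <= t.
  rewrite -lee_fin -Tt; apply: ereal_sup_ubound; exists y, (f y); split=> //.
    exact/Tf.
  rewrite normr_Re -(rmorph1 (real_complex R)) lecR.
  by rewrite -(@expr_le1 _ 2) ?Re_norm_ge0 // -(sqnE hip) Ny.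
rewrite -(@ler_pXn2r _ 2) ?nnegrE ?Re_norm_ge0 // -(sqnE hip).
rewrite (clinearZ _ _ fl) sqnZ exprVn mulrC ler_pdivrMr ?exprn_gt0 //.
by rewrite (sqnE hip x).
Qed.

Lemma op_norm_le (T : set (V * V)) (t : R) : 0 <= t ->
  (forall x y, T (x, y) -> N y <= t ^+ 2 * N x) -> (op_norm T <= t%:E)%E.
Proof.
move=> t0 Tt; apply: ge_ereal_sup => _ [x [y [Txy x1 ->]]].
rewrite lee_fin -lecR -normr_Re.
have := Tt _ _ Txy; rewrite -(sqn_le_norm hip) // => /le_trans; apply.
by rewrite ler_piMr // ler0c.
Qed.

End OperatorNorm.

(** * Square roots and quotients of the given operators *)

Section Assembly.
Variables (R : realType) (V : completeNormedModType (complex R)).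
Variable ip : {dot V for (@Num.conj (complex R))}.
Hypothesis hip : induces_norm ip.
Local Notation r := (rip ip).
Local Notation N := (sqn ip).
Local Notation "a %:C" := (real_complex R a) (at level 1).

Lemma op_sqrtP (A : set (V * V)) : real_psa ip A ->
  real_psa ip (op_sqrt ip A) /\ op_mul (op_sqrt ip A) (op_sqrt ip A) = A.
Proof.
move=> Ap; have [S [Sp SA]] := psa_sqrt hip Ap.
have : exists S, positive_selfadjoint ip S /\ op_mul S S = A.
  by exists S; split; [apply/(real_psaP hip)|].
move=> /(xgetPex set0)[h1 h2].
by split; [apply/(real_psaP hip)|].
Qed.

Lemma equivalent_dominated (A B : set (V * V)) :
  is_operator A -> is_operator B ->
  op_dom A = op_dom B /\ equivalent_graph_norms A B <->
  exists c d : R, [/\ 0 < c, 0 < d, dominated ip (c ^+ 2) A B &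
    dominated ip (d ^+ 2) B A].
Proof.
move=> Ao Bo; split=> [[domE [c [d [c0 d0 h]]]]|[c [d [c0 d0 AB BA]]]].
  have [c' c'0 cE] := gt0_complexE c0; have [d' d'0 dE] := gt0_complexE d0.
  subst c d; exists c', d'; split=> // x v hx.
    have [u Au] : op_dom A x by rewrite domE; exists v.
    by exists u => //; have [] := h _ _ _ Au hx; rewrite (sqn_le_norm hip _ _ (ltW c'0)).
  have [u Bu] : op_dom B x by rewrite -domE; exists v.
  by exists u => //; have [_] := h _ _ _ hx Bu; rewrite (sqn_le_norm hip _ _ (ltW d'0)).
split.
  apply/seteqP; split=> x [u hx].
    by have [v Bv _] := BA _ _ hx; exists v.
  by have [v Av _] := AB _ _ hx; exists v.
exists c%:C, d%:C; split; rewrite ?ltcR // => x u v Au Bv.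
rewrite !(sqn_le_norm hip) ?(ltW c0) ?(ltW d0) //.
have [u' Au' hu] := AB _ _ Bv; have [v' Bv' hv] := BA _ _ Au.
by rewrite {1}(op_fun Ao Au Au') {2}(op_fun Bo Bv Bv').
Qed.

Lemma quotients_well_defined (A B : set (V * V)) (k l : R) :
  0 < k -> 0 < l -> real_psa ip A -> real_psa ip B ->
  dominated ip k A B -> dominated ip l B A ->
  closure_well_defined_bounded (op_mul (op_inv A) B) /\
  closure_well_defined_bounded (op_mul A (op_inv B)).
Proof.
move=> k0 l0 Ap Bp AB BA; split.
  apply: (bounded_closure_well_defined hip (ltW l0)).
  - exact: op_inv_mul_is_operator Ap (psa_op Bp).
  - exact: (inv_mul_dense hip Bp Ap l0 BA).
  - exact: (inv_mul_bound hip Bp Ap l0 BA).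
apply: (bounded_closure_well_defined hip (ltW k0)).
- exact: op_mul_inv_is_operator (psa_op Ap) Bp.
- exact: (mul_inv_dense hip Bp AB).
- exact: (mul_inv_bound Ap AB).
Qed.

Lemma op_sub_graph (A B : set (V * V)) (f g : V -> V) :
  (forall x y, A (x, y) <-> y = f x) -> (forall x y, B (x, y) <-> y = g x) ->
  forall x y, op_sub A B (x, y) <-> y = f x - g x.
Proof.
move=> Af Bg x y; split=> [[u [v [/= /Af -> /Bg -> ->]]] //|->].
by exists (f x), (g x); split=> //; [apply/Af|apply/Bg].
Qed.

Lemma clinear_sub (f g : V -> V) :
  clinear f -> clinear g -> clinear (fun x => f x - g x).
Proof. by move=> fl gl a x y; rewrite fl gl opprD addrACA -scalerBr. Qed.

Lemma op_norm_sub_le_half (A B m h : set (V * V)) (c d k l : R) :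
  0 < c -> 0 < d -> 0 < k -> 0 < l ->
  real_psa ip A -> real_psa ip B -> real_psa ip m -> real_psa ip h ->
  op_mul m m = A -> op_mul h h = B ->
  dominated ip c A B -> dominated ip d B A -> dominated ip k m h -> dominated ip l h m ->
  (op_norm (op_sub (closure (op_mul m (op_inv h))) (closure (op_mul (op_inv m) h))) <=
   (2^-1)%:E * op_norm (op_sub (closure (op_mul A (op_inv B)))
                               (closure (op_mul (op_inv A) B))))%E.
Proof.
move=> c0 d0 k0 l0 Ap Bp mp hp mA hB AB BA mh hm.
have [W [Wl Wb WE hW]] := mul_inv_closure hip mp hp k0 mh.
have [Wi [Wil Wib WiE hWi hWi']] := inv_mul_closure hip hp mp l0 k0 hm mh.
have [T1 [T1l _ T1E hT1]] := mul_inv_closure hip Ap Bp c0 AB.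
have [T2 [T2l _ T2E _ hT2]] := inv_mul_closure hip Bp Ap d0 c0 BA AB.
have XE := op_sub_graph WE WiE; have TE := op_sub_graph T1E T2E.
set X := op_sub _ _ in XE *; set T := op_sub _ _ in TE *.
have Tl := clinear_sub T1l T2l.
have T00 : T (0, 0) by apply/TE; rewrite (clinear0 Tl).
have := op_norm_ge0 T00; case Tn : (op_norm T) => [t| |//]; last first.
  by rewrite gt0_muley ?leey // lte_fin invr_gt0.
rewrite lee_fin => t0; rewrite -EFinM mulrC.
apply: (op_norm_le hip) => [|x y /XE ->]; first by rewrite divr_ge0.
have TN := le_op_norm hip Tl TE Tn.
apply: (sylvester_bound hip t0 Ap Bp mp hp mA hB (clinear_sub Wl Wil)).
  exists (2 * k + 2 * l) => z; have := sqnD_le hip (W z) (- Wi z).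
  by rewrite sqnN; have := Wb z; have := Wib z; lra.
move=> f {}x p q g {}y s w hfx hxp hpq mgy mys msw.
rewrite (weak_sylvester hip k0 l0 Ap Bp mp hp mA hB AB BA mh hm
  hW hWi hWi' hT1 hT2 hfx hxp hpq mgy mys msw).
rewrite (ripC ip q) -(psa_sym hp hxp hpq) (ripC ip w) -(psa_sym mp mys msw).
rewrite -[r p p]/(N p) -[r s s]/(N s); move: (TN p); set z := T1 p - T2 p => hz.
have [tz|tn0] := eqVneq t 0.
  have -> : z = 0.
    apply/(sqn_eq0 hip)/eqP; rewrite eq_le sqn_ge0 // andbT.
    by move: hz; rewrite tz expr0n mul0r.
  by rewrite rip0l tz mulr0 mul0r.
have tp : 0 < t by rewrite lt_def tn0.
have := rip_leZ hip z s (_ : 0 < t^-1); rewrite invr_gt0 invrK => /(_ tp).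
have : t^-1 * N z <= t * N p by rewrite ler_pdivrMl // mulrA -expr2.
lra.
Qed.

End Assembly.

Theorem theorem5p1 (R : realType) (V : completeNormedModType (complex R))
    (ip : {dot V for (@Num.conj (complex R))}) (hip : induces_norm ip)
    (H M : set (V * V))
    (hH : positive_selfadjoint ip H) (hM : positive_selfadjoint ip M)
    (hHM : propertyA ip H M) :
  let H2 := op_sqrt ip H in let M2 := op_sqrt ip M in
  let H4 := op_root4 ip H in let M4 := op_root4 ip M in
  let T := op_sub (closure (op_mul M2 (op_inv H2)))
                  (closure (op_mul (op_inv M2) H2)) in
  let X := op_sub (closure (op_mul M4 (op_inv H4)))
                  (closure (op_mul (op_inv M4) H4)) in
  [/\ propertyA ip H2 M2,
      [/\ closure_well_defined_bounded (op_mul (op_inv M2) H2),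
          closure_well_defined_bounded (op_mul M2 (op_inv H2)),
          closure_well_defined_bounded (op_mul (op_inv M4) H4)
        & closure_well_defined_bounded (op_mul M4 (op_inv H4))],
      [/\ closure_well_defined_bounded (op_mul (op_inv H2) M2),
          closure_well_defined_bounded (op_mul H2 (op_inv M2)),
          closure_well_defined_bounded (op_mul (op_inv H4) M4)
        & closure_well_defined_bounded (op_mul H4 (op_inv M4))]
    & (op_norm X <= (2^-1)%:E * op_norm T)%E].
Proof.
move: hH hM => /(real_psaP hip) Hp /(real_psaP hip) Mp H2 M2 H4 M4 T X.
have [H2p _] := op_sqrtP hip Hp; have [M2p _] := op_sqrtP hip Mp.
have [H4p H4H2] := op_sqrtP hip H2p; have [M4p M4M2] := op_sqrtP hip M2p.
have [c [d [c0 d0 BA AB]]] := (equivalent_dominated hip (psa_op H2p) (psa_op M2p)).1 hHM.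
have mh := heinz hip d0 M4p H4p M2p H2p M4M2 H4H2 AB.
have hm := heinz hip c0 H4p M4p H2p M2p H4H2 M4M2 BA.
have [c2 d2] := (exprn_gt0 2 c0, exprn_gt0 2 d0).
have [q1 q2] := quotients_well_defined hip d2 c2 M2p H2p AB BA.
have [q3 q4] := quotients_well_defined hip d0 c0 M4p H4p mh hm.
have [q5 q6] := quotients_well_defined hip c2 d2 H2p M2p BA AB.
have [q7 q8] := quotients_well_defined hip c0 d0 H4p M4p hm mh.
split; [|by split|by split|].
  apply/(equivalent_dominated hip (psa_op H4p) (psa_op M4p)).
  exists (Num.sqrt c), (Num.sqrt d).
  by rewrite !sqrtr_gt0 !sqr_sqrtr ?(ltW c0) ?(ltW d0).
exact: (op_norm_sub_le_half hip d2 c2 d0 c0 M2p H2p M4p H4p M4M2 H4H2 AB BA mh hm).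
Qed.
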